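(* Let $Y$ be a general diffusion in natural scale with state space $I$, interior $I^\circ=(l,r)$, speed measure $m$ and absorbing accessible boundary points, let $(a_h)_{h\in(0,\bar h)}$ be scale factors, and let $I_h$ and the embedding stopping times $(\tau^h_k)_{k\in\mathbb N_0}$ be as defined in the context. Assume that $$\sup_{y\in I_h}\left|\frac12\int_{(y-a_h(y),y+a_h(y))}\bigl(a_h(y)-|u-y|\bigr)\,m(du)-h\right|\in o(h),\qquad h\to0.$$ Let $\alpha\in(0,\infty)$, $T\in(0,\infty)$ and $y\in I^\circ$. Then $$\sup_{k\in\{1,\ldots,\lfloor T/h\rfloor\}}\left|\tau^h_k-kh\right|\xrightarrow{\ L^\alpha(P_y)\ }0,\qquad h\to0.$$
   Context: General diffusion: $I\subseteq\mathbb R$ is an open, half-open or closed interval with interior $I^\circ=(l,r)$, $-\infty\le l<r\le\infty$, and $\bar I=[l,r]$. $(\Omega,\mathcal F,(\mathcal F_t)_{t\ge0},(P_y)_{y\in I},(Y_t)_{t\ge0})$ is a one-dimensional continuous strong Markov process with state space $I$ and $P_y[Y_0=y]=1$ for $y\in I$ (in the sense of Revuz–Yor, Section VII.3). For $x\in\bar I$ let $H_x=\inf\{t\ge0:Y_t=x\}$ and $H_{a,b}=H_a\wedge H_b$. $Y$ is regular: $P_y[H_x<\infty]>0$ for all $y\in I^\circ$, $x\in I$. $Y$ is in natural scale: $P_y[H_b<H_a]=\frac{y-a}{b-a}$ for $a<y<b$, $a,b\in I$. A boundary point is accessible if and only if it belongs to $I$, and every accessible boundary point is absorbing. The speed measure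 $m$ satisfies $0<m([a,b])<\infty$ for all $a<b$ in $I^\circ$ and is normalized so that $E_y[H_{a,b}]=\int_{(a,b)}\frac{(b-y\vee u)(y\wedge u-a)}{b-a}\,m(du)$ for all $a<b$ in $I$ and $y\in[a,b]$ (so Brownian motion has speed measure $2\,dx$). Scale factors: $\bar h\in(0,\infty)$ and for every $h\in(0,\bar h)$, $a_h\colon\bar I\to[0,\infty)$ is measurable with $a_h(l)=a_h(r)=0$ and $y\pm a_h(y)\in I$ for all $y\in I^\circ$. The set $I_h$: if $l>-\infty$, $l_h:=l+\inf\{a\in(0,\frac{r-l}2]: a<\infty,\ \frac12\int_{(l,l+2a)}(a-|u-(l+a)|)\,m(du)\ge h\}$ with $\inf\emptyset=\infty$; if $l=-\infty$, $l_h:=-\infty$. If $r<\infty$, $r_h:=r-\inf\{a\in(0,\frac{r-l}2]: a<\infty,\ \frac12\int_{(r-2a,r)}(a-|u-(r-a)|)\,m(du)\ge h\}$; if $r=\infty$, $r_h:=\infty$. Put $I_h=(l_h,r_h)\cup\{y\in I^\circ: y\pm a_h(y)\in I^\circ\}$. Standing assumption: $\bar h$ is small enough that, if both $l$ and $r$ are finite, then for all $h\in(0,\bar h)$ the two infima are finite and $a_h(\frac{l+r}2)<\frac{r-l}2$. Embedding stopping times (for $Y$ started in $y\in I^\circ$): $\tau^h_0=0$. Given $\tau^h_k$, let $\sigma^h_{k+1}=\inf\{t\ge\tau^h_k: |Y_t-Y_{\tau^h_k}|=a_h(Y_{\tau^h_k})\}$. On $\{Y_{\tau^h_k}\in I_h\}$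 set $\tau^h_{k+1}=\sigma^h_{k+1}$. On $\{Y_{\tau^h_k}=v\}$ with $v\in I^\circ\setminus I_h$ (so that $v-a_h(v)=l$ or $v+a_h(v)=r$) set $\tau^h_{k+1}=\sigma^h_{k+1}+2(h-c)1_{\{l,r\}}(Y_{\sigma^h_{k+1}})$, where $c=E_v[H_{v-a_h(v),v+a_h(v)}]$ $(\le h)$. On $\{Y_{\tau^h_k}\in\{l,r\}\}$ set $\tau^h_{k+1}=\tau^h_k+h$. For $\alpha\in(0,\infty)$, $\|\xi\|_{L^\alpha(P_y)}=(E_y|\xi|^\alpha)^{1/\alpha}$, and convergence in $L^\alpha(P_y)$ means $\|\cdot\|_{L^\alpha(P_y)}\to0$. A supremum over an empty set is $0$. *)

(* Defs.v *)
From HB Require Import structures.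
From mathcomp Require Import all_boot all_order all_algebra.
From mathcomp Require Import all_classical all_reals all_analysis.
From mathcomp Require Import measurable_realfun.

Set Implicit Arguments.
Unset Strict Implicit.
Unset Printing Implicit Defensive.

Import Order.TTheory GRing.Theory Num.Theory.
Import numFieldNormedType.Exports.

Local Open Scope classical_set_scope.
Local Open Scope ring_scope.
Local Open Scope ereal_scope.

(* Time is [0, +oo): a process is a function Y : R -> Omega -> R of which only
   the values at t >= 0 are ever used; the same holds for filtrations. Random
   times take values in \bar R. A family (P_y) of laws is indexed by R, but
   only the P y with y in the state space are ever used. *)

Definition interior_of (R : realType) (l r : \bar R) : set R :=
  [set x | l < x%:E < r].

Definition is_boundary (R : realType) (l r : \bar R) : set R :=
  [set x | x%:E = l \/ x%:E = r].

Record filtration (d : measure_display) (R : realType)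
    (Omega : measurableType d) (F : R -> set (set Omega)) : Prop := {
  filtration_sigma_algebra : forall t : R, (0 <= t)%R ->
    sigma_algebra [set: Omega] (F t) ;
  filtration_measurable : forall t : R, (0 <= t)%R ->
    F t `<=` @measurable d Omega ;
  filtration_nondecreasing : forall s t : R, (0 <= s)%R -> (s <= t)%R ->
    F s `<=` F t
}.

Definition stopping_time (d : measure_display) (R : realType)
    (Omega : measurableType d) (F : R -> set (set Omega))
    (S : Omega -> \bar R) : Prop :=
  (forall w, 0 <= S w) /\
  (forall t : R, (0 <= t)%R -> F t [set w | S w <= t%:E]).

(* the sigma-algebra F_S of events prior to S *)
Definition stopped_sigma_algebra (d : measure_display) (R : realType)
    (Omega : measurableType d) (F : R -> set (set Omega))
    (S : Omega -> \bar R) : set (set Omega) :=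
  [set A | measurable A /\
    forall t : R, (0 <= t)%R -> F t (A `&` [set w | S w <= t%:E])].

(* the sigma-algebra generated by the coordinate maps p |-> p t, t >= 0 *)
Definition path_sigma_algebra (R : realType) : set (set (R -> R)) :=
  <<s [set C : set (R -> R) | exists t : R, (0 <= t)%R /\
         exists B : set R, measurable B /\ C = [set p | B (p t)]] >>.

Definition path_law (d : measure_display) (R : realType)
    (Omega : measurableType d) (P : R -> probability Omega R)
    (Y : R -> Omega -> R) (y : R) (C : set (R -> R)) : \bar R :=
  P y [set w | C (fun t => Y t w)].

Record continuous_strong_markov (d : measure_display) (R : realType)
    (Omega : measurableType d) (I : set R) (F : R -> set (set Omega))
    (P : R -> probability Omega R) (Y : R -> Omega -> R) : Prop := {
  markov_filtration : filtration F ;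
  markov_adapted : forall t : R, (0 <= t)%R ->
    forall B : set R, measurable B -> F t (Y t @^-1` B) ;
  markov_state_space : forall (t : R) (w : Omega), (0 <= t)%R -> I (Y t w) ;
  markov_continuous : forall w : Omega,
    {within [set t : R | (0 <= t)%R], continuous (fun t => Y t w)} ;
  markov_start : forall y : R, I y -> P y [set w | Y 0%R w = y] = 1 ;
  markov_kernel : forall C : set (R -> R), path_sigma_algebra C ->
    measurable_fun I (fun y => path_law P Y y C) ;
  markov_strong : forall (y : R) (S : Omega -> \bar R) (A : set Omega)
      (C : set (R -> R)),
    I y -> stopping_time F S -> stopped_sigma_algebra F S A ->
    path_sigma_algebra C ->
    P y (A `&` [set w | S w < +oo] `&`
         [set w | C (fun t => Y (fine (S w) + t)%R w)]) =
    \int[P y]_(w in A `&` [set w | S w < +oo])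
       path_law P Y (Y (fine (S w)) w) C
}.

(* H_x, for x in [l, r] (possibly infinite) *)
Definition hitting_time (R : realType) (Omega : Type) (Y : R -> Omega -> R)
    (x : \bar R) (w : Omega) : \bar R :=
  ereal_inf [set t%:E | t in [set t : R | (0 <= t)%R /\ (Y t w)%:E = x]].

(* H_{a,b} *)
Definition hitting_time2 (R : realType) (Omega : Type) (Y : R -> Omega -> R)
    (a b : \bar R) (w : Omega) : \bar R :=
  Order.min (hitting_time Y a w) (hitting_time Y b w).

Definition accessible (d : measure_display) (R : realType)
    (Omega : measurableType d) (l r : \bar R)
    (P : R -> probability Omega R) (Y : R -> Omega -> R) (b : \bar R) : Prop :=
  exists2 y : R, interior_of l r y &
    0 < P y [set w | hitting_time Y b w < +oo].

(* The speed measure m is given as a measure on R, of which only the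
   restriction to the interior (l, r) is ever used. *)
Record general_diffusion (d : measure_display) (R : realType)
    (Omega : measurableType d) (I : set R) (l r : \bar R)
    (F : R -> set (set Omega)) (P : R -> probability Omega R)
    (Y : R -> Omega -> R) (m : {measure set R -> \bar R}) : Prop := {
  diffusion_lt : l < r ;
  diffusion_sub_interior : interior_of l r `<=` I ;
  diffusion_sub_closure : I `<=` [set x | l <= x%:E <= r] ;
  diffusion_markov : continuous_strong_markov I F P Y ;
  diffusion_regular : forall y x : R, interior_of l r y -> I x ->
    0 < P y [set w | hitting_time Y x%:E w < +oo] ;
  diffusion_natural_scale : forall a y b : R, I a -> I b ->
    (a < y)%R -> (y < b)%R ->
    P y [set w | hitting_time Y b%:E w < hitting_time Y a%:E w] =
    ((y - a) / (b - a))%:E ;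
  diffusion_accessible : forall b : \bar R, b = l \/ b = r ->
    (accessible l r P Y b <-> exists2 x : R, I x & x%:E = b) ;
  diffusion_absorbing : forall b : R, is_boundary l r b ->
    accessible l r P Y b%:E ->
    P b [set w | forall t : R, (0 <= t)%R -> Y t w = b] = 1 ;
  diffusion_speed_locally_finite : forall a b : R,
    interior_of l r a -> interior_of l r b -> (a < b)%R ->
    0 < m `[a, b]%classic < +oo ;
  diffusion_speed : forall a b y : R, I a -> I b -> (a < b)%R ->
    (a <= y)%R -> (y <= b)%R ->
    \int[P y]_w hitting_time2 Y a%:E b%:E w =
    \int[m]_(u in `]a, b[)
      ((b - Num.max y u) * (Num.min y u - a) / (b - a))%:E
}.

(* 1/2 \int_{(y-a, y+a)} (a - |u - y|) m(du); the integrals that define l_h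
   and r_h are the cases y = l + a and y = r - a. *)
Definition half_tent_integral (R : realType) (m : {measure set R -> \bar R})
    (y a : R) : \bar R :=
  (2^-1)%:E * \int[m]_(u in `](y - a)%R, (y + a)%R[) (a - `|u - y|)%:E.

Definition left_inf (R : realType) (l r : \bar R)
    (m : {measure set R -> \bar R}) (h : R) : \bar R :=
  ereal_inf [set a%:E | a in [set a : R |
    [/\ (0 < a)%R, a%:E <= (r - l) * (2^-1)%:E &
        h%:E <= half_tent_integral m (fine l + a)%R a]]].

Definition right_inf (R : realType) (l r : \bar R)
    (m : {measure set R -> \bar R}) (h : R) : \bar R :=
  ereal_inf [set a%:E | a in [set a : R |
    [/\ (0 < a)%R, a%:E <= (r - l) * (2^-1)%:E &
        h%:E <= half_tent_integral m (fine r - a)%R a]]].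

(* l_h *)
Definition left_cut (R : realType) (l r : \bar R)
    (m : {measure set R -> \bar R}) (h : R) : \bar R :=
  if l == -oo then -oo else l + left_inf l r m h.

(* r_h *)
Definition right_cut (R : realType) (l r : \bar R)
    (m : {measure set R -> \bar R}) (h : R) : \bar R :=
  if r == +oo then +oo else r - right_inf l r m h.

(* I_h *)
Definition central_set (R : realType) (l r : \bar R)
    (m : {measure set R -> \bar R}) (a : R -> \bar R -> R) (h : R) : set R :=
  [set y | left_cut l r m h < y%:E < right_cut l r m h] `|`
  [set y | [/\ interior_of l r y, interior_of l r (y - a h y%:E)%R &
               interior_of l r (y + a h y%:E)%R]].

Record scale_factors (R : realType) (I : set R) (l r : \bar R) (hbar : R)
    (a : R -> \bar R -> R) : Prop := {
  scale_measurable : forall h : R, (0 < h < hbar)%R ->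
    measurable_fun [set x : \bar R | l <= x <= r] (a h) ;
  scale_ge0 : forall (h : R) (x : \bar R), (0 < h < hbar)%R ->
    l <= x <= r -> (0 <= a h x)%R ;
  scale_left : forall h : R, (0 < h < hbar)%R -> a h l = 0%R ;
  scale_right : forall h : R, (0 < h < hbar)%R -> a h r = 0%R ;
  scale_state_space : forall h y : R, (0 < h < hbar)%R ->
    interior_of l r y -> I (y - a h y%:E)%R /\ I (y + a h y%:E)%R
}.

Definition hbar_small (R : realType) (l r : \bar R)
    (m : {measure set R -> \bar R}) (hbar : R) (a : R -> \bar R -> R) : Prop :=
  l \is a fin_num -> r \is a fin_num ->
  forall h : R, (0 < h < hbar)%R ->
    [/\ left_inf l r m h \is a fin_num, right_inf l r m h \is a fin_num &
        (a h ((l + r) * (2^-1)%:E)%E)%:E < (r - l) * (2^-1)%:E].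

(* sigma^h_{k+1} as a function of s = tau^h_k; it is +oo if s = +oo, since the
   set is then empty. *)
Definition exit_time (R : realType) (Omega : Type) (Y : R -> Omega -> R)
    (a : R -> \bar R -> R) (h : R) (s : \bar R) (w : Omega) : \bar R :=
  let x := Y (fine s) w in
  ereal_inf [set t%:E | t in
    [set t : R | s <= t%:E /\ `|Y t w - x|%R = a h x%:E]].

(* E_v[H_{v-a_h(v), v+a_h(v)}] *)
Definition mean_exit_time (d : measure_display) (R : realType)
    (Omega : measurableType d) (P : R -> probability Omega R)
    (Y : R -> Omega -> R) (a : R -> \bar R -> R) (h v : R) : \bar R :=
  \int[P v]_w
    hitting_time2 Y (v - a h v%:E)%:E (v + a h v%:E)%:E w.

(* tau^h_k; the last branch is the one where Y is at a boundary point (or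
   tau^h_k = +oo, in which case all branches give +oo). *)
Fixpoint embedding_time (d : measure_display) (R : realType)
    (Omega : measurableType d) (l r : \bar R) (P : R -> probability Omega R)
    (Y : R -> Omega -> R) (m : {measure set R -> \bar R})
    (a : R -> \bar R -> R) (h : R) (k : nat) (w : Omega) : \bar R :=
  if k is k'.+1 then
    let s := embedding_time l r P Y m a h k' w in
    let v := Y (fine s) w in
    let e := exit_time Y a h s w in
    if v \in central_set l r m a h then e
    else if v \in interior_of l r then
      e + (2 * (h - fine (mean_exit_time P Y a h v))
             * \1_(is_boundary l r) (Y (fine e) w))%:E
    else s + h%:E
  else 0.

(* sup_{y in I_h} |1/2 \int_{(y-a_h(y), y+a_h(y))} (a_h(y)-|u-y|) m(du) - h|;
   the maximum with 0 makes the supremum over the empty set 0. *)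
Definition scale_error (R : realType) (l r : \bar R)
    (m : {measure set R -> \bar R}) (a : R -> \bar R -> R) (h : R) : \bar R :=
  Order.max 0 (ereal_sup
    [set `|half_tent_integral m y (a h y%:E) - h%:E| |
       y in central_set l r m a h]).

(* f(h) \in o(h) as h -> 0+, for an extended-real f >= 0 *)
Definition is_little_o_id (R : realType) (f : R -> \bar R) : Prop :=
  forall eps : R, (0 < eps)%R -> \forall h \near 0%R^'+, f h <= (eps * h)%:E.

(* sup_{k in {1, ..., floor(T/h)}} |tau^h_k - k h| *)
Definition max_time_error (d : measure_display) (R : realType)
    (Omega : measurableType d) (l r : \bar R) (P : R -> probability Omega R)
    (Y : R -> Omega -> R) (m : {measure set R -> \bar R})
    (a : R -> \bar R -> R) (T h : R) (w : Omega) : \bar R :=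
  \big[Order.max/0]_(1 <= k < (Num.truncn (T / h)).+1)
    `|embedding_time l r P Y m a h k w - (k%:R * h)%:E|.

(* Main.v *)
Require Import Defs.
From HB Require Import structures.
From mathcomp Require Import all_boot all_order all_algebra.
From mathcomp Require Import all_classical all_reals all_analysis.
From mathcomp Require Import measurable_realfun.
From mathcomp Require Import ring lra.
Set Implicit Arguments.
Unset Strict Implicit.
Unset Printing Implicit Defensive.
Import Order.TTheory GRing.Theory Num.Theory.
Import numFieldNormedType.Exports.
Local Open Scope classical_set_scope.
Local Open Scope ring_scope.
Local Open Scope ereal_scope.

(** Write D_k = tau_k - k h and rho_k = tau_{k+1} - tau_k.

    Wherever Y is at time tau_k, the conditional mean of rho_k is h up to
    eps h. At a point v of I_h this is the hypothesis, because
    half_tent_integral m v a is the mean exit time from (v - a, v + a)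
    [mean_exit_center]. At an interior point outside I_h exactly one end of
    the exit interval is an end point of (l, r); it is reached first with
    probability 1/2, so the delay 2 (h - c) paid there moves the mean from c to
    exactly h. At an end point of (l, r), rho_k = h.

    Moreover rho_k / h has an exponential moment bounded uniformly in h and in
    the position. Started anywhere in (v - a, v + a), Y leaves this interval
    after a mean time of at most twice the one for the centre, hence of order
    h, and the Markov property turns this into geometric tails
    [exit_exp_moment]. Since e^x <= 1 + x + x^2 e^|x|, both facts give, for
    |theta| at most a constant over h,

      E[exp (theta (rho_k - h)) | F_{tau_k}]
        <= 1 + |theta| eps h + C theta^2 h^2          [one_step_exp],

    and the strong Markov property iterates this to
    E exp (theta D_k) <= exp (T (|theta| eps + C theta^2 h)) for k <= T / h
    [exp_deviation_le]. Take theta = h^{-1/2} and theta = - h^{-1/2}. Then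
    |D_k| > delta costs a factor exp (- delta h^{-1/2} / 2), of which
    exp (eps T h^{-1/2}) gives back at most half the exponent when eps is
    small; the rest beats the number T / h of indices. So the maximum over k
    is bounded by the sum over k [max_error_moment_le], and all powers alpha
    are covered together because x^alpha <= C e^{x/2} [powR_le_cut_exp].

    To use the strong Markov property at tau_k, this must be a stopping time
    of the given raw filtration, and functionals of the path must be measurable
    for the sigma-algebra generated by the coordinates on the space of all
    functions. For the latter, hitting times are replaced by versions that look
    at rational times and agree with them on continuous paths [rational_hit].
    For the former, tau_{k+1} is tau_k plus a functional of the path after
    tau_k [embedding_timeS] that satisfies Galmarino's test: whether its value
    is at most u is decided by the path stopped at u [stopping_time_add]. *)

(** * Paths and hitting times *)

(** The generator of path_sigma_algebra. It is kept separate so that the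
    path space becomes a measurable type, on which functionals of the path can
    be integrated. *)
Definition cylinder (R : realType) : set (set (R -> R)) :=
  [set C : set (R -> R) | exists t : R, (0 <= t)%R /\
     exists B : set R, measurable B /\ C = [set p | B (p t)]].

Arguments cylinder : clear implicits.

Notation paths R := (g_sigma_algebraType (cylinder R)).

Definition continuous_path (R : realType) (p : R -> R) : Prop :=
  {within [set t : R | (0 <= t)%R], continuous p}.

Lemma continuous_pathP (R : realType) (p : R -> R) :
  continuous_path p <->
  (forall t e : R, 0 <= t -> 0 < e -> exists2 d : R, 0 < d &
     forall u, 0 <= u -> `|t - u| < d -> `|p t - p u| < e)%R.
Proof.
split=> [cp t e t0 e0|H].
  have /subspace_continuousP/(_ t t0)/cvgrPdist_lt/(_ e e0) := cp.
  case=> d /= d0 H; exists d => // u u0 tu; exact: (H u tu u0).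
apply/subspace_continuousP => t t0; apply/cvgrPdist_lt => e e0.
have [d d0 Hd] := H t e t0 e0.
by exists d => //= u tu u0; exact: Hd.
Qed.

Lemma continuous_path_shift (R : realType) (p : R -> R) (s : R) :
  (0 <= s)%R -> continuous_path p -> continuous_path (fun t => p (s + t)%R).
Proof.
move=> s0 /continuous_pathP cp; apply/continuous_pathP => t e t0 e0.
have [d d0 H] := cp (s + t)%R e (addr_ge0 s0 t0) e0.
exists d => // u u0 tu; apply: H; first exact: addr_ge0.
by rewrite opprD addrACA subrr add0r.
Qed.

Lemma continuous_path_stop (R : realType) (p : R -> R) (s : R) :
  (0 <= s)%R -> continuous_path p -> continuous_path (fun t => p (Num.min t s)).
Proof.
move=> s0 /continuous_pathP cp; apply/continuous_pathP => t e t0 e0.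
have ts0 : (0 <= Num.min t s)%R by rewrite le_min t0.
have [d d0 H] := cp _ e ts0 e0.
exists d => // u u0 tu; apply: H; first by rewrite le_min u0.
apply: le_lt_trans tu.
rewrite ler_norml; have := ler_norm (t - u); have := ler_normr (t-u) (t-u).
rewrite lexx /= => _; have := ler_norm (u - t); rewrite distrC.
by rewrite /Num.min; case: ifP; case: ifP => /=; lra.
Qed.

(** The level may depend on the starting point p 0, so that the exit from
    the interval of radius a(p 0) around p 0 is expressed by two such times. *)
Definition hit (R : realType) (b : R -> R) (p : R -> R) : \bar R :=
  ereal_inf [set t%:E | t in [set t : R | (0 <= t)%R /\ p t = b (p 0%R)]].

Lemma hit_ge0 (R : realType) (b : R -> R) (p : R -> R) : 0 <= hit b p.
Proof.
by apply: le_ereal_inf_tmp => _ [t [t0 _] <-]; rewrite lee_fin.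
Qed.

Lemma path_level_min (R : realType) (p : R -> R) (c s : R) :
  (0 <= s)%R -> continuous_path p ->
  exists2 t0, (0 <= t0 <= s)%R &
    forall t, (0 <= t <= s)%R -> (`|p t0 - c| <= `|p t - c|)%R.
Proof.
move=> s0 cp.
have cps : {within `[0%R, s]%classic, continuous (fun t => `|p t - c|%R)}.
  have : {within `[0%R, s]%classic, continuous p}.
    apply: continuous_subspaceW cp => t /=; rewrite in_itv/= => /andP[]//.
  move=> cs t; apply: cvg_norm; apply: cvgB; [exact: cs|exact: cvg_cst].
have [t0 + H] := EVT_min s0 cps.
by rewrite in_itv /= => t0s; exists t0 => // t ts; apply: H.
Qed.

(** The infimum is attained: if the least distance of p to the level over
    [0, s] were positive, continuity at s would keep p off the level for a
    while after s. *)
Lemma hit_le (R : realType) (b : R -> R) (p : R -> R) (s : R) :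
  continuous_path p -> (0 <= s)%R ->
  hit b p <= s%:E <-> exists2 t, (0 <= t <= s)%R & p t = b (p 0%R).
Proof.
move=> cp s0; split; last first.
  move=> [t /andP[t0 ts] pt]; apply: ge_ereal_inf; exists t%:E => //.
  by exists t.
move=> hs; have [t0 t0s mt0] := path_level_min (b (p 0%R)) s0 cp.
exists t0 => //; apply/eqP; rewrite -subr_eq0 -normr_le0 leNgt; apply/negP.
set c := b _ in mt0 * => m0.
have [d d0 Hd] := (continuous_pathP p).1 cp s _ s0 m0.
suff : (s + d)%:E <= hit b p.
  by move/le_trans/(_ hs); rewrite lee_fin gerDl leNgt d0.
apply: le_ereal_inf_tmp => _ [t [t_0 pt] <-]; rewrite lee_fin leNgt; apply/negP.
move=> tsd; have [ts|st] := leP t s.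
  have := mt0 t; rewrite t_0 ts pt -/c subrr normr0 => /(_ isT).
  by rewrite leNgt m0.
have := Hd t t_0; rewrite pt -/c ltr0_norm ?subr_lt0//.
rewrite opprB ltrBlDl => /(_ tsd); rewrite ltNge mt0//.
by rewrite s0 lexx.
Qed.

(** On a continuous path this says that the level is reached by time s, by
    compactness of [0, s]. It refers to countably many coordinates only, and
    therefore is an event on the space of all functions. *)
Definition approaches (R : realType) (b : R -> R) (s : R) : set (R -> R) :=
  \bigcap_(n in [set: nat]) \bigcup_(q in [set: rat])
    [set p | (0 <= (ratr q : R) <= s /\ `|p (ratr q) - b (p 0)| < n.+1%:R^-1)%R].

Lemma approachesP (R : realType) (b : R -> R) (p : R -> R) (s : R) :
  continuous_path p -> (0 <= s)%R ->
  approaches b s p <-> exists2 t, (0 <= t <= s)%R & p t = b (p 0%R).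
Proof.
move=> cp s0; split.
  move=> H; have [t0 t0s mt0] := path_level_min (b (p 0%R)) s0 cp.
  exists t0 => //; apply/eqP; rewrite -subr_eq0 -normr_le0 leNgt.
  apply/negP => m0.
  have [n Hn] := ltr_add_invr m0.
  rewrite add0r in Hn.
  have [q _ [qs]] := H n I; apply/negP; rewrite -leNgt.
  by apply: le_trans (mt0 _ qs); exact: ltW.
move=> [t /andP[t0 ts] pt] n _.
have n0 : (0 < n.+1%:R^-1 :> R)%R by rewrite invr_gt0.
have [d d0 Hd] := (continuous_pathP p).1 cp t _ t0 n0.
move: t0; rewrite le_eqVlt => /predU1P[t0|t0].
  exists 0%R => //=; rewrite rmorph0 lexx s0; split => //.
  by rewrite -pt -t0 subrr normr0.
have [q] : exists q : rat, ratr q \in `](Num.max 0 (t - d))%R, t[.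
  have : (Num.max 0 (t - d) < t)%R by rewrite gt_max t0 ltrBlDr ltrDl.
  exact: rat_in_itvoo.
rewrite in_itv /= gt_max => /andP[/andP[q0 qd] qt].
exists q => //=; split; first by rewrite (ltW q0) (le_trans (ltW qt) ts).
by rewrite -pt distrC; apply: Hd; [exact: ltW|rewrite gtr0_norm; lra].
Qed.

(** A version of hit that is measurable on the space of all functions. *)
Definition rational_hit (R : realType) (b : R -> R) (p : R -> R) : \bar R :=
  ereal_inf [set (ratr q)%:E | q in [set q : rat |
    (0 <= ratr q :> R)%R /\ approaches b (ratr q) p]].

Lemma rational_hitE (R : realType) (b : R -> R) (p : R -> R) :
  continuous_path p -> rational_hit b p = hit b p.
Proof.
move=> cp; apply/eqP; rewrite eq_le; apply/andP; split; last first.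
  apply: le_ereal_inf_tmp => _ [q [q0 /approachesP aq] <-].
  by apply/hit_le => //; exact: aq.
apply/lee_addgt0Pr => e e0.
case hE : (hit b p) => [s| |]; last 2 first.
- by rewrite addye// leey.
- by have := hit_ge0 b p; rewrite hE.
have s0 : (0 <= s)%R by rewrite -lee_fin -hE hit_ge0.
have [t /andP[t0 ts] pt] : exists2 t, (0 <= t <= s)%R & p t = b (p 0%R).
  by apply/hit_le => //; rewrite hE.
have [q] : exists q : rat, ratr q \in `]s, (s + e)%R[.
  by apply: rat_in_itvoo; rewrite ltrDl.
rewrite in_itv /= => /andP[sq qse].
apply: ge_ereal_inf; exists (ratr q)%:E; last by rewrite -EFinD lee_fin ltW.
exists q => //; have q0 : (0 <= ratr q :> R)%R by rewrite (le_trans s0)// ltW.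
split => //; apply/approachesP => //; exists t => //.
by rewrite t0 (le_trans ts)// ltW.
Qed.

Lemma measurable_path_eval (R : realType) (t : R) : (0 <= t)%R ->
  measurable_fun [set: paths R] (fun p : paths R => (p : R -> R) t).
Proof.
move=> t0 _ B mB; rewrite setTI; apply: sub_sigma_algebra.
by exists t; split => //; exists B.
Qed.

Lemma measurable_to_paths d (T : measurableType d) (R : realType)
    (f : T -> R -> R) :
  (forall t, (0 <= t)%R -> measurable_fun [set: T] (f ^~ t)) ->
  measurable_fun [set: T] (f : T -> paths R).
Proof.
move=> mf; have := @measurability _ _ T (paths R) setT f (cylinder R); apply => //.
move=> _ [_ [t [t0 [B [mB ->]]] <-]].
exact: mf.
Qed.

Lemma measurable_approaches (R : realType) (b : R -> R) (s : R) :
  measurable_fun [set: R] b ->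
  measurable (approaches b s : set (paths R)).
Proof.
move=> mb; apply: bigcapT_measurable => n; apply: bigcupT_measurable_rat => q.
have [qs|/negP qs] := boolP (0 <= (ratr q : R) <= s)%R; last first.
  rewrite (_ : mkset _ = set0) ?measurable0//.
  by apply/seteqP; split => p //= [].
have q0 : (0 <= (ratr q : R))%R by case/andP: qs.
pose g (p : paths R) : R := `|(p : R -> R) (ratr q) - b ((p : R -> R) 0)|%R.
have mg : measurable_fun [set: paths R] g.
  apply: measurableT_comp; first exact: measurable_realfun.normr_measurable.
  apply: measurable_funB; first exact: measurable_path_eval.
  by apply: measurableT_comp => //; exact: measurable_path_eval.
rewrite (_ : mkset _ = g @^-1` `]-oo, (n.+1%:R^-1)%R[%classic); last first.
  by apply/seteqP; split => p /=; rewrite in_itv/=; [case|split].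
by rewrite -[X in measurable X]setTI; apply: mg.
Qed.

Lemma measurable_rational_hit (R : realType) (b : R -> R) :
  measurable_fun [set: R] b -> measurable_fun [set: paths R] (rational_hit b).
Proof.
move=> mb; apply: (measurability _ (ErealGenCInfty.measurableE R)) => //.
move=> _ [_ [x ->] <-]; rewrite setTI.
rewrite -[X in measurable X]setCK; apply: measurableC.
rewrite (_ : ~` _ = \bigcup_(q in [set: rat])
    (if (0 <= (ratr q : R))%R && (ratr q < x)%R
     then approaches b (ratr q) else set0)).
  apply: bigcupT_measurable_rat => q; case: ifP => _ //.
  exact: measurable_approaches.
apply/seteqP; split => p /=.
  move=> /negP; rewrite in_itv /= andbT -ltNge => /ereal_inf_ltP[_ [q [q0 aq] <-]].
  by rewrite lte_fin => qx; exists q => //=; rewrite q0 qx.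
move=> [q _ /=]; case: ifP => // /andP[q0 qx] aq.
apply/negP; rewrite in_itv /= andbT -ltNge.
by apply/ereal_inf_ltP; exists (ratr q)%:E; [exists q|rewrite lte_fin].
Qed.

(** Galmarino's test for hit: a level not reached by time u is never reached
    by the path stopped at u. *)
Lemma hit_stop (R : realType) (b : R -> R) (p : R -> R) (u : R) :
  continuous_path p -> (0 <= u)%R ->
  hit b (fun t => p (Num.min t u)) = if hit b p <= u%:E then hit b p else +oo.
Proof.
move=> cp u0; have m0 : Num.min 0%R u = 0%R by rewrite (min_idPl _).
case: ifPn => hu.
  apply/eqP; rewrite eq_le; apply/andP; split; last first.
    apply: le_ereal_inf_tmp => _ [t [t0 pt] <-]; rewrite m0 in pt.
    apply: (@le_trans _ _ (Num.min t u)%:E).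
      by apply/hit_le => //; rewrite ?le_min ?t0//; exists (Num.min t u); rewrite ?lexx ?le_min ?t0 ?u0.
    by rewrite lee_fin ge_min lexx.
  have [h hE] : exists h, hit b p = h%:E.
    case: (hit b p) hu (hit_ge0 b p) => [h| |]//= _ _; by exists h.
  rewrite hE in hu *; rewrite lee_fin in hu.
  have h0 : (0 <= h)%R by rewrite -lee_fin -hE hit_ge0.
  have [t /andP[t0 th] pt] : exists2 t, (0 <= t <= h)%R & p t = b (p 0%R).
    by apply/hit_le => //; rewrite hE.
  apply/hit_le => //; first exact: continuous_path_stop.
  exists t; first by rewrite t0.
  by rewrite m0 (min_idPl _)// (le_trans th).
apply/ereal_inf_pinfty => _ [t [t0 pt] <-]; rewrite m0 in pt.
exfalso; move/negP: hu; apply; apply/hit_le => //.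
by exists (Num.min t u) => //; rewrite le_min t0 u0 ge_min lexx orbT.
Qed.

(** * Stopping times *)

(** By continuity X at time sigma is the limit of X at the times
    floor (n sigma) / n, which take countably many values. *)
Lemma measurable_process_at d (T : measurableType d) (R : realType)
    (X : R -> T -> R) (sigma : T -> R) :
  (forall t, (0 <= t)%R -> measurable_fun [set: T] (X t)) ->
  (forall w, continuous_path (X ^~ w)) ->
  measurable_fun [set: T] sigma -> (forall w, (0 <= sigma w)%R) ->
  measurable_fun [set: T] (fun w => X (sigma w) w).
Proof.
move=> mX cX ms s0.
pose g (n : nat) w : R :=
  ((Num.truncn (sigma w * n.+1%:R))%:R / n.+1%:R)%R.
apply: (@measurable_fun_cvg _ _ _ _ (fun n w => X (g n w) w)); last first.
  move=> w _; apply/cvgrPdist_lt => e e0.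
  have [dl dl0 H] := (continuous_pathP _).1 (cX w) (sigma w) e (s0 w) e0.
  have [N HN] := ltr_add_invr dl0; rewrite add0r in HN.
  exists N => // n /= Nn; apply: H.
    by rewrite /g divr_ge0.
  apply: le_lt_trans HN.
  have n0 : (0 < n.+1%:R :> R)%R by rewrite ltr0n.
  have /andP[tl tu] := truncn_itv (mulr_ge0 (s0 w) (ltW n0)).
  rewrite -/(g n w) ger0_norm; last by rewrite subr_ge0 /g ler_pdivrMr.
  apply: (@le_trans _ _ n.+1%:R^-1%R); last by rewrite lef_pV2 ?posrE// ler_nat.
  rewrite /g lerBlDr -[X in (_ <= X + _)%R]div1r -mulrDl ler_pdivlMr//.
  by rewrite addrC natr1 ltW.
move=> n _ B mB; rewrite setTI.
have n0 : (0 < n.+1%:R :> R)%R by rewrite ltr0n.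
rewrite (_ : _ @^-1` B = \bigcup_(k in [set: nat])
  (sigma @^-1` `[(k%:R / n.+1%:R)%R, (k.+1%:R / n.+1%:R)%R[%classic `&`
   X (k%:R / n.+1%:R)%R @^-1` B)).
  apply: bigcupT_measurable => k; apply: measurableI.
    by rewrite -[X in measurable X]setTI; apply: ms.
  by rewrite -[X in measurable X]setTI; apply: mX => //; rewrite divr_ge0.
have key w k : (k%:R / n.+1%:R <= sigma w < k.+1%:R / n.+1%:R)%R ->
    Num.truncn (sigma w * n.+1%:R) = k.
  by rewrite ler_pdivrMr// ltr_pdivlMr// => /truncn_def.
apply/seteqP; split => w /=.
  move=> Bw; exists (Num.truncn (sigma w * n.+1%:R)) => //=; split => //.
  rewrite in_itv /= ler_pdivrMr// ltr_pdivlMr//; apply: truncn_itv.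
  exact: (mulr_ge0 (s0 w) (ltW n0)).
by move=> [k _ /=]; rewrite in_itv /= => -[/key]; rewrite /g => ->.
Qed.

Section step.
Context (R : realType).
Implicit Types (A : set R) (up dn xup xdn b : R -> R) (h : R) (p : R -> R).

(** The duration of one step of the embedding as a functional of the path:
    started in A, the exit time through up or dn plus a delay that depends on
    the end reached, and h otherwise. H stands for hit or for its measurable
    version. *)
Definition step_with (H : (R -> R) -> (R -> R) -> \bar R)
    A up dn xup xdn h p : \bar R :=
  if p 0%R \in A then
    if H up p < H dn p then H up p + (xup (p 0%R))%:E
    else H dn p + (xdn (p 0%R))%:E
  else h%:E.

Definition step := step_with (@hit R).
Definition rational_step := step_with (@rational_hit R).

Lemma rational_stepE A up dn xup xdn h p : continuous_path p ->
  rational_step A up dn xup xdn h p = step A up dn xup xdn h p.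
Proof. by move=> cp; rewrite /rational_step /step /step_with !rational_hitE. Qed.

Lemma measurable_rational_step A up dn xup xdn h : measurable A ->
  measurable_fun [set: R] up -> measurable_fun [set: R] dn ->
  measurable_fun [set: R] xup -> measurable_fun [set: R] xdn ->
  measurable_fun [set: paths R] (rational_step A up dn xup xdn h).
Proof.
move=> mA mup mdn mxup mxdn.
have m0 := @measurable_path_eval R 0%R (lexx _).
apply: measurable_fun_ifT.
- apply: (@measurable_fun_bool _ _ _ _ true).
  rewrite setTI (_ : _ @^-1` _ = (fun p : paths R => (p : R -> R) 0%R) @^-1` A).
    by rewrite -[X in measurable X]setTI; apply: m0.
  by apply/seteqP; split => p /=; [move/set_mem|move/mem_set].
- apply: measurable_fun_ifT.
  + by apply: measurable_fun_lte; exact: measurable_rational_hit.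
  + apply: emeasurable_funD; first exact: measurable_rational_hit.
    by apply/measurable_EFinP; exact: measurableT_comp.
  + apply: emeasurable_funD; first exact: measurable_rational_hit.
    by apply/measurable_EFinP; exact: measurableT_comp.
- exact: measurable_cst.
Qed.

Lemma step_ge0 A up dn xup xdn h p :
  (0 <= h)%R -> (forall x, 0 <= xup x)%R -> (forall x, 0 <= xdn x)%R ->
  0 <= step A up dn xup xdn h p.
Proof.
move=> h0 xu xd; rewrite /step /step_with.
by repeat case: ifP => _; rewrite ?adde_ge0 ?hit_ge0 ?lee_fin.
Qed.

(** A step is at least as long as the first of the two hitting times, so a
    step of length at most u is not affected by stopping the path at u. *)
Lemma step_stop A up dn xup xdn h p u :
  (forall x, 0 <= xup x)%R -> (forall x, 0 <= xdn x)%R ->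
  continuous_path p -> (0 <= u)%R ->
  (step A up dn xup xdn h (fun t => p (Num.min t u)) <= u%:E) =
  (step A up dn xup xdn h p <= u%:E).
Proof.
move=> xu xd cp u0; rewrite /step /step_with (min_idPl u0).
case: ifP => // _.
rewrite !hit_stop//; move: (xu (p 0%R)) (xd (p 0%R)).
have addF (y : R) (x : \bar R) : (0 <= y)%R -> ~~ (x <= u%:E) ->
    (x + y%:E <= u%:E) = false.
  move=> y0 /negP xu'; apply/negP => xyu; apply: xu'; apply: le_trans xyu.
  by rewrite leeDl.
have addT (y : R) : (+oo + y%:E <= u%:E) = false by [].
case: (boolP (hit up p <= u%:E)) => Hu;
  case: (boolP (hit dn p <= u%:E)) => Hd => // xup0 xdn0.
- have -> : hit up p < +oo by apply: le_lt_trans Hu _; rewrite ltry.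
  have -> : hit up p < hit dn p by apply: le_lt_trans Hu _; rewrite ltNge.
  by [].
- rewrite ltNge leey /=.
  have -> // : (hit up p < hit dn p) = false.
  by apply/negP => /lt_le_trans/(_ Hd) /ltW; exact/negP.
- by rewrite ltxx addT; case: ifP => _; rewrite addF.
Qed.

End step.

Lemma fine_mineK (R : realType) (x : \bar R) (t : R) : 0 <= x -> (0 <= t)%R ->
  (fine (Order.min x t%:E))%:E = Order.min x t%:E.
Proof.
move=> x0 t0; rewrite fineK// ge0_fin_numE; last by rewrite le_min x0 lee_fin.
by rewrite gt_min ltry orbT.
Qed.

Section stopping.
Context d (R : realType) (Omega : measurableType d) (F : R -> set (set Omega))
  (Y : R -> Omega -> R).
Hypothesis filt : filtration F.
Hypothesis adapted : forall t : R, (0 <= t)%R ->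
    forall B : set R, measurable B -> F t (Y t @^-1` B).
Hypothesis contY : forall w, continuous_path (Y ^~ w).

Lemma filtration_sigmaE t : (0 <= t)%R -> <<s F t >> = F t.
Proof. by move=> t0; apply: sigma_algebra_id; exact: filtration_sigma_algebra. Qed.

Lemma process_measurable t : (0 <= t)%R -> measurable_fun [set: Omega] (Y t).
Proof.
move=> t0 _ B mB; rewrite setTI.
exact: (filtration_measurable filt t0 (adapted t0 mB)).
Qed.

Lemma stopping_time_measurable S : stopping_time F S ->
  measurable_fun [set: Omega] S.
Proof.
move=> [S0 mS]; apply: (measurability _ (ErealGenOInfty.measurableE R)) => //.
move=> _ [_ [x ->] <-]; rewrite setTI.
rewrite -[X in measurable X]setCK; apply: measurableC.
have [x0|x0] := ltP x 0%R.
  rewrite (_ : ~` _ = set0); first exact: measurable0.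
  apply/seteqP; split => w //=; rewrite in_itv /= andbT; apply.
  by apply: lt_le_trans (S0 w); rewrite lte_fin.
rewrite (_ : ~` _ = [set w | S w <= x%:E]).
  exact: (filtration_measurable filt x0 (mS _ x0)).
apply/seteqP; split => w /=; by rewrite in_itv /= andbT leNgt => /negP.
Qed.

Definition after (S : Omega -> \bar R) (w : Omega) : R -> R :=
  fun t => Y (fine (S w) + t)%R w.

Lemma fine_stopping_ge0 S w : stopping_time F S -> (0 <= fine (S w))%R.
Proof. by move=> [S0 _]; exact: fine_ge0. Qed.

Lemma continuous_after S w : stopping_time F S -> continuous_path (after S w).
Proof.
by move=> st; apply: (@continuous_path_shift _ (Y ^~ w)) => //; exact: fine_stopping_ge0.
Qed.

Lemma measurable_after S : stopping_time F S ->
  measurable_fun [set: Omega] (after S : Omega -> paths R).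
Proof.
move=> st; apply: measurable_to_paths => t t0.
apply: (@measurable_process_at _ _ _ Y (fun w => fine (S w) + t)%R) => //.
- exact: process_measurable.
- apply: measurable_funD => //; apply: measurableT_comp => //.
  exact: stopping_time_measurable.
- by move=> w; rewrite addr_ge0// fine_stopping_ge0.
Qed.

(** Measurability for F t is handled as measurability on a second measurable
    type with carrier Omega. *)
Lemma filtration_measurableE t (A : set Omega) : (0 <= t)%R ->
  measurable (A : set (g_sigma_algebraType (F t))) = F t A.
Proof.
by move=> t0; rewrite -[RHS](congr1 (fun G => G A) (filtration_sigmaE t0)).
Qed.

Lemma measurable_min_time S t : stopping_time F S -> (0 <= t)%R ->
  measurable_fun [set: g_sigma_algebraType (F t)]
    (fun w => fine (Order.min (S w) t%:E)).
Proof.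
move=> [S0 mS] t0; set sig := fun w => _.
have sigF w : (sig w)%:E = Order.min (S w) t%:E by exact: fine_mineK.
have sig0 w : (0 <= sig w)%R by rewrite -lee_fin sigF le_min S0 lee_fin.
apply: (measurability _ (@RGenOInfty.measurableE R)) => //.
move=> _ [_ [x ->] <-]; rewrite setTI.
rewrite -[X in measurable X]setCK; apply: measurableC.
have [x0|x0] := ltP x 0%R.
  rewrite (_ : ~` _ = set0); first exact: measurable0.
  apply/seteqP; split => w //=; rewrite in_itv /= andbT; apply.
  exact: lt_le_trans x0 (sig0 w).
have [tx|xt] := leP t x.
  rewrite (_ : ~` _ = setT); first exact: measurableT.
  apply/seteqP; split => w //= _; rewrite in_itv /= andbT; apply/negP.
  by rewrite -leNgt -lee_fin sigF ge_min !lee_fin tx orbT.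
rewrite (_ : ~` _ = [set w | S w <= x%:E]); last first.
  have sx w : (S w <= x%:E) = ~~ (x < sig w)%R.
    by rewrite -leNgt -lee_fin sigF ge_min !lee_fin (leNgt t) xt orbF.
  by apply/seteqP; split => w /=; rewrite in_itv /= andbT sx => /negP.
by rewrite filtration_measurableE //; apply: (filtration_nondecreasing filt x0 (ltW xt)); exact: mS.
Qed.

(** On the event S <= t, the path after S stopped at t - S only involves Y up
    to time t, and by Galmarino's test for rho it decides whether
    rho <= t - S. *)
Lemma stopping_time_add (S : Omega -> \bar R) (rho mrho : (R -> R) -> \bar R) :
  stopping_time F S ->
  (forall p, 0 <= rho p) ->
  measurable_fun [set: paths R] (mrho : paths R -> \bar R) ->
  (forall p, continuous_path p -> mrho p = rho p) ->
  (forall p u, continuous_path p -> (0 <= u)%R ->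
     (rho (fun t => p (Num.min t u)) <= u%:E) = (rho p <= u%:E)) ->
  stopping_time F (fun w => S w + rho (after S w)).
Proof.
move=> st rho0 mmrho mrhoE rho_stop; have [S0 mS] := st.
split=> [w|t t0]; first by rewrite adde_ge0.

pose sig w := fine (Order.min (S w) t%:E).
have sigE w : S w <= t%:E -> sig w = fine (S w).
  by move=> h; rewrite /sig (min_idPl h).
have sigF w : (sig w)%:E = Order.min (S w) t%:E by exact: fine_mineK.
have sig0 w : (0 <= sig w)%R by rewrite -lee_fin sigF le_min S0 lee_fin.
pose Ot : measurableType _ := g_sigma_algebraType (F t).
have OtE A := filtration_measurableE A t0.
have msig : measurable_fun [set: Ot] (sig : Ot -> R) := measurable_min_time st t0.
pose X w : R -> R := fun u => Y (Num.min (sig w + u) t)%R w.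
have mX : measurable_fun [set: Ot] (X : Ot -> paths R).
  apply: measurable_to_paths => u u0.
  pose Z (s : R) (w : Ot) := Y (Num.min s t) w.
  apply: (@measurable_process_at _ Ot _ Z (fun w => sig w + u)%R).
  - move=> s s0 _ B mB; rewrite setTI OtE.
    have st0 : (0 <= Num.min s t)%R by rewrite le_min s0.
    apply: (filtration_nondecreasing filt st0); first by rewrite ge_min lexx orbT.
    exact: adapted.
  - by move=> w; apply: (@continuous_path_stop _ (Y ^~ w)).
  - exact: measurable_funD.
  - by move=> w; rewrite addr_ge0.
have -> : [set w | S w + rho (after S w) <= t%:E] =
    [set w | S w <= t%:E] `&` [set w | (sig w)%:E + mrho (X w) <= t%:E].
  have H w : S w <= t%:E -> (S w + rho (after S w) <= t%:E) =
      ((sig w)%:E + mrho (X w) <= t%:E).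
    move=> Swt; have sigt : (sig w <= t)%R.
      by rewrite -lee_fin sigF ge_min lexx orbT.
    have XE : X w = (fun u => after S w (Num.min u (t - sig w)%R)).
      apply/funext => u; rewrite /X /after -sigE//; congr (Y _ w).
      by rewrite addr_minr [(sig w + (t - _))%R]addrC subrK.
    have ca := @continuous_after S w st.
    have ts0 : (0 <= t - sig w)%R by rewrite subr_ge0.
    rewrite XE mrhoE; last exact: continuous_path_stop.
    have -> : S w = (sig w)%:E by rewrite sigF (min_idPl Swt).
    by rewrite -!leeBrDl// -EFinB rho_stop.
  apply/seteqP; split => w /=; last by move=> [h1]; rewrite -H.
  move=> h1; have h2 : S w <= t%:E by apply: le_trans h1; rewrite leeDl.
  by rewrite -H.
have FtI (A B : set Omega) : F t A -> F t B -> F t (A `&` B).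
  by rewrite -!OtE; exact: measurableI.
apply: FtI; first exact: mS.
rewrite -OtE -[X in measurable X]setTI.
have mf : measurable_fun [set: Ot] (fun w => (sig w)%:E + mrho (X w)).
  apply: (@emeasurable_funD _ Ot _ _ (EFin \o sig) (mrho \o X)).
    exact/measurable_EFinP.
  exact: measurableT_comp mX.
by have := emeasurable_fun_infty_c (@measurableT _ Ot) mf t%:E.
Qed.

Lemma stopping_time_cst (s : R) : (0 <= s)%R -> stopping_time F (fun=> s%:E).
Proof.
move=> s0; split=> [w|t t0]; first by rewrite lee_fin.
rewrite -(filtration_sigmaE t0).
have [st|ts] := boolP (s%:E <= t%:E).
  rewrite (_ : mkset _ = setT); first exact: (@measurableT _ (g_sigma_algebraType (F t))).
  by apply/seteqP; split.
rewrite (_ : mkset _ = set0); first exact: (@measurable0 _ (g_sigma_algebraType (F t))).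
by apply/seteqP; split => w //= h; rewrite h in ts.
Qed.

(** Makes functions of S admissible as weights in the strong Markov
    property. *)
Lemma stopped_preimage S (B : set R) : stopping_time F S -> measurable B ->
  stopped_sigma_algebra F S ([set w | S w < +oo] `&` ((fun w => fine (S w)) @^-1` B)).
Proof.
move=> st mB; have [S0 mS] := st; split.
  apply: measurableI.
    rewrite -[X in measurable X]setTI; apply: emeasurable_fun_infty_o => //.
    exact: stopping_time_measurable.
  rewrite -[X in measurable X]setTI; apply: measurableT_comp => //.
  exact: stopping_time_measurable.
move=> t t0; pose sig w := fine (Order.min (S w) t%:E).
rewrite [X in F t X](_ : _ = [set w | S w <= t%:E] `&` sig @^-1` B); last first.
  apply/seteqP; split => w /=.
    by move=> [[Soo SB] St]; split; rewrite /sig ?(min_idPl St).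
  move=> [St]; rewrite /sig (min_idPl St) => SB; split; last exact: St.
  split; last exact: SB.
  by apply: le_lt_trans St _; rewrite ltry.
rewrite -filtration_measurableE//; apply: measurableI.
  by rewrite filtration_measurableE//; exact: mS.
rewrite -[X in measurable X]setTI; exact: (measurable_min_time st t0).
Qed.

End stopping.

(** * The strong Markov property for functionals of the path *)

Import HBNNSimple.

Section approx.
Context d d' (T : measurableType d) (T' : measurableType d') (R : realType)
  (mu : {measure set T -> \bar R}) (D : set T) (X : T -> T').
Hypotheses (mD : measurable D) (mX : measurable_fun [set: T] X).

Lemma integral_nnsfun_comp (g : {nnsfun T' >-> R}) :
  \int[mu]_(w in D) (g (X w))%:E =
  \sum_(x \in range g) (x%:E * mu (D `&` X @^-1` (g @^-1` [set x]))).
Proof.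
have mg x : measurable (g @^-1` [set x]) by exact: measurable_sfunP.
have m1 x : measurable_fun D (fun w => \1_(g @^-1` [set x]) (X w) : R).
  by apply: measurable_funTS; exact: measurableT_comp mX.
have mi x : measurable (X @^-1` (g @^-1` [set x])).
  by rewrite -[X in measurable X]setTI; apply: mX => //; exact: measurable_sfunP.
under eq_integral => w _ do rewrite fimfunE -fsumEFin//.
rewrite ge0_integral_fsum//; last 2 first.
- move=> x; apply/measurable_EFinP; apply: measurable_funM => //.
- by move=> x w _; rewrite EFinM nnfun_muleindic_ge0.
apply: eq_fsbigr => x /set_mem [z _ gz].
have x0 : (0 <= x)%R by rewrite -gz.
under eq_integral => w _ do rewrite EFinM.
rewrite ge0_integralZl_EFin//; last exact/measurable_EFinP.
congr (_ * _); rewrite setIC -(integral_indic mu mD (mi x)).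
exact: eq_integral.
Qed.

Lemma integral_approx_comp (G : T' -> \bar R) (mG : measurable_fun [set: T'] G) :
  (forall x, 0 <= G x) ->
  \int[mu]_(w in D) (nnsfun_approx measurableT mG n (X w))%:E @[n --> \oo]
    --> \int[mu]_(w in D) G (X w).
Proof.
move=> G0.
have cG x : (nnsfun_approx measurableT mG n x)%:E @[n --> \oo] --> G x.
  exact: cvg_nnsfun_approx.
rewrite [X in _ --> X](_ : _ = \int[mu]_(w in D)
    limn (fun n => (nnsfun_approx measurableT mG n (X w))%:E)); last first.
  by apply: eq_integral => w _; apply/esym/cvg_lim.
apply: cvg_monotone_convergence => //.
- move=> n; apply/measurable_EFinP; apply: measurable_funTS.
  exact: measurableT_comp.
- by move=> n w _; rewrite lee_fin.
- move=> w _ n m nm; rewrite lee_fin.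
  exact/lefP/nd_nnsfun_approx.
Qed.

End approx.

Lemma path_sigma_algebra_sfun (R : realType) (g : {nnsfun (paths R) >-> R}) x :
  path_sigma_algebra (g @^-1` [set x]).
Proof. by have : measurable (g @^-1` [set x]) by exact: measurable_sfunP. Qed.

Section strong_markov.
Context d (R : realType) (Omega : measurableType d) (I : set R)
  (F : R -> set (set Omega)) (P : R -> probability Omega R)
  (Y : R -> Omega -> R).
Hypothesis mI : measurable I.
Hypothesis markov : continuous_strong_markov I F P Y.

Let filt := markov_filtration markov.
Let adapted := markov_adapted markov.
Let contY : forall w, continuous_path (Y ^~ w) := markov_continuous markov.

Definition traj (w : Omega) : R -> R := fun t => Y t w.

Lemma measurable_traj : measurable_fun [set: Omega] (traj : Omega -> paths R).
Proof.
apply: measurable_to_paths => t t0.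
exact: (process_measurable filt adapted).
Qed.

Definition path_mean (v : R) (G : paths R -> \bar R) : \bar R :=
  \int[P v]_w G (traj w).

Lemma path_mean_nnsfun (g : {nnsfun (paths R) >-> R}) v :
  path_mean v (EFin \o g) = \sum_(x \in range g) (x%:E * path_law P Y v (g @^-1` [set x])).
Proof.
rewrite /path_mean (integral_nnsfun_comp _ measurableT measurable_traj).
by apply: eq_fsbigr => x _; rewrite setTI.
Qed.

Lemma path_mean_ge0 v G : (forall p, 0 <= G p) -> 0 <= path_mean v G.
Proof. by move=> G0; apply: integral_ge0. Qed.

Lemma measurable_path_mean (G : paths R -> \bar R) :
  measurable_fun [set: paths R] G -> (forall p, 0 <= G p) ->
  measurable_fun I (fun v => path_mean v G).
Proof.
move=> mG G0.
apply: (@emeasurable_fun_cvg _ _ _ _ (fun n v => path_mean v (EFin \o nnsfun_approx measurableT mG n))).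
  move=> n; under eq_fun do rewrite path_mean_nnsfun.
  apply: emeasurable_fsum => // x.
  apply: emeasurable_funM; first exact: measurable_cst.
  by apply: (markov_kernel markov); exact: path_sigma_algebra_sfun.
by move=> v _; apply: integral_approx_comp => //; exact: measurable_traj.
Qed.

Lemma measurable_start_comp S (f : R -> \bar R) : stopping_time F S ->
  measurable_fun I f ->
  measurable_fun [set: Omega] (fun w => f (Y (fine (S w)) w)).
Proof.
move=> st mf.
have mX : measurable_fun [set: Omega] (after Y S : Omega -> paths R).
  exact: (measurable_after filt adapted contY).
have mYS : measurable_fun [set: Omega] (fun w => Y (fine (S w)) w).
  have := measurableT_comp (measurable_path_eval (lexx 0%R)) mX.
  by congr (measurable_fun _ _); apply/funext => w /=; rewrite /after addr0.
apply: (measurable_comp mI) mYS => //.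
move=> _ [w _ <-]; apply: (markov_state_space markov).
exact: fine_stopping_ge0 st.
Qed.

(** From events to functionals of the path, by simple functions and monotone
    convergence. *)
Lemma strong_markov_mean (y : R) S A (G : paths R -> \bar R) :
  I y -> stopping_time F S -> stopped_sigma_algebra F S A ->
  measurable_fun [set: paths R] G -> (forall p, 0 <= G p) ->
  \int[P y]_(w in A `&` [set w | S w < +oo]) G (after Y S w) =
  \int[P y]_(w in A `&` [set w | S w < +oo]) path_mean (Y (fine (S w)) w) G.
Proof.
move=> Iy st FA mG G0.
set D := _ `&` _.
have mA : measurable A by case: FA.
have mS := stopping_time_measurable filt st.
have mD : measurable D.
  apply: measurableI => //; rewrite -[X in measurable X]setTI.
  exact: emeasurable_fun_infty_o.
have mX : measurable_fun [set: Omega] (after Y S : Omega -> paths R).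
  exact: (measurable_after filt adapted contY).
have mcomp (f : R -> \bar R) (mf : measurable_fun I f) := measurable_start_comp st mf.
have key n : \int[P y]_(w in D) (nnsfun_approx measurableT mG n (after Y S w))%:E =
    \int[P y]_(w in D) path_mean (Y (fine (S w)) w) (EFin \o nnsfun_approx measurableT mG n).
  set g := nnsfun_approx _ _ _.
  rewrite (integral_nnsfun_comp _ mD mX).
  under [RHS]eq_integral => w _ do rewrite path_mean_nnsfun.
  rewrite ge0_integral_fsum//; last 2 first.
  - move=> x; apply: emeasurable_funM; first exact: measurable_cst.
    apply: measurable_funTS; apply: (mcomp (fun v => path_law P Y v (g @^-1` [set x]))).
    by apply: (markov_kernel markov); exact: path_sigma_algebra_sfun.
  - move=> x w _; have [x0|x0] := leP 0%R x.
      by rewrite mule_ge0.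
    by rewrite preimage_nnfun0// /path_law (_ : mkset _ = set0) ?measure0 ?mule0.
  apply: eq_fsbigr => x /set_mem [z _ gz].
  have x0 : (0 <= x)%R by rewrite -gz.
  rewrite ge0_integralZl_EFin//; last first.
    apply: measurable_funTS; apply: (mcomp (fun v => path_law P Y v (g @^-1` [set x]))).
    by apply: (markov_kernel markov); exact: path_sigma_algebra_sfun.
  congr (_ * _); rewrite -(markov_strong markov Iy st FA); last exact: path_sigma_algebra_sfun.
  by [].
have c1 := @integral_approx_comp _ _ _ _ _ (P y) D _ mD mX G mG G0.
have mgt n : measurable_fun [set: Omega] (fun w => (nnsfun_approx measurableT mG n (traj w))%:E).
  apply/measurable_EFinP.
  exact: (measurableT_comp _ measurable_traj).
have c2 : \int[P y]_(w in D) path_mean (Y (fine (S w)) w)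
      (EFin \o nnsfun_approx measurableT mG n) @[n --> \oo]
    --> \int[P y]_(w in D) path_mean (Y (fine (S w)) w) G.
  have cG v : path_mean v (EFin \o nnsfun_approx measurableT mG n) @[n --> \oo] --> path_mean v G.
    by apply: integral_approx_comp => //; exact: measurable_traj.
  rewrite [X in _ --> X](_ : _ = \int[P y]_(w in D) limn (fun n =>
      path_mean (Y (fine (S w)) w) (EFin \o nnsfun_approx measurableT mG n))); last first.
    by apply: eq_integral => w _; apply/esym/cvg_lim.
  apply: cvg_monotone_convergence => //.
  - move=> n; apply: measurable_funTS.
    apply: (mcomp (fun v => path_mean v (EFin \o nnsfun_approx measurableT mG n))).
    apply: measurable_path_mean; first exact/measurable_EFinP.
    by move=> p; rewrite lee_fin.
  - by move=> n w _; apply: path_mean_ge0 => p; rewrite lee_fin.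
  - move=> w _ n m nm; apply: ge0_le_integral => //.
    + by move=> ? _; rewrite lee_fin.
    + exact: mgt.
    + exact: mgt.
    + by move=> p _; rewrite lee_fin; exact: (lefP _ _ (nd_nnsfun_approx measurableT mG nm)).
by rewrite -(cvg_lim _ c1)// -(cvg_lim _ c2)//; congr (limn _); apply/funext.
Qed.

Lemma strong_markov_le (y K : R) S A (G : paths R -> \bar R) :
  I y -> stopping_time F S -> stopped_sigma_algebra F S A ->
  measurable_fun [set: paths R] G -> (forall p, 0 <= G p) -> (0 <= K)%R ->
  (forall w, A w -> S w < +oo -> path_mean (Y (fine (S w)) w) G <= K%:E) ->
  \int[P y]_(w in A `&` [set w | S w < +oo]) G (after Y S w) <=
  K%:E * P y (A `&` [set w | S w < +oo]).
Proof.
move=> Iy st FA mG G0 K0 HK; rewrite strong_markov_mean//.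
have mA : measurable A by case: FA.
have mS := stopping_time_measurable filt st.
have mD : measurable (A `&` [set w | S w < +oo]).
  apply: measurableI => //; rewrite -[X in measurable X]setTI.
  exact: emeasurable_fun_infty_o.
rewrite -(integral_cst (P y) mD); apply: ge0_le_integral => //.
- by move=> w _; exact: path_mean_ge0.
- apply: measurable_funTS; apply: (measurable_start_comp st (f := fun v => path_mean v G)).
  exact: measurable_path_mean.
- by move=> w [Aw Sw]; exact: HK.
Qed.

(** The form in which the strong Markov property is iterated: phi S is the
    exponential weight collected up to S and g the factor contributed by the
    next increment. *)
Lemma strong_markov_weighted_le (y K : R) S (phi : R -> R) (g : paths R -> R) :
  I y -> stopping_time F S ->
  measurable_fun [set: R] phi -> (forall x, 0 <= phi x)%R ->
  measurable_fun [set: paths R] g -> (forall p, 0 <= g p)%R -> (0 <= K)%R ->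
  (forall v, I v -> path_mean v (EFin \o g) <= K%:E) ->
  \int[P y]_(w in [set w | S w < +oo])
     ((phi (fine (S w)))%:E * (g (after Y S w))%:E) <=
  K%:E * \int[P y]_(w in [set w | S w < +oo]) (phi (fine (S w)))%:E.
Proof.
move=> Iy st mphi phi0 mg g0 K0 HK.
have mS := stopping_time_measurable filt st.
set D := [set w | _].
have mD : measurable D.
  by rewrite -[X in measurable X]setTI; exact: emeasurable_fun_infty_o.
have mf : measurable_fun [set: Omega] (fun w => fine (S w)) by exact: measurableT_comp.
have mephi : measurable_fun [set: R] (EFin \o phi) by exact/measurable_EFinP.
have ephi0 x : 0 <= (EFin \o phi) x by rewrite lee_fin.
have mX : measurable_fun [set: Omega] (after Y S : Omega -> paths R).
  exact: (measurable_after filt adapted contY).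
have mgX : measurable_fun [set: Omega] (fun w => (g (after Y S w))%:E).
  by apply/measurable_EFinP; exact: (measurableT_comp mg mX).
pose f n : {nnsfun R >-> R} := nnsfun_approx measurableT mephi n.
have key n : \int[P y]_(w in D) ((f n (fine (S w)))%:E * (g (after Y S w))%:E) <=
    K%:E * \int[P y]_(w in D) (f n (fine (S w)))%:E.
  have mB x : measurable (f n @^-1` [set x]) by exact: measurable_sfunP.
  have mSB x : measurable ((fun w => fine (S w)) @^-1` (f n @^-1` [set x])).
    by rewrite -[X in measurable X]setTI; exact: mf.
  have m1 x : measurable_fun D (fun w => \1_(f n @^-1` [set x]) (fine (S w)) : R).
    by apply: measurable_funTS; exact: measurableT_comp mf.
  rewrite integral_nnsfun_comp// ge0_mule_fsumr; last first.
    move=> x; have [x0|x0] := leP 0%R x; first by rewrite mule_ge0.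
    by rewrite preimage_nnfun0// preimage_set0 setI0 measure0 mule0.
  under eq_integral => w _.
    rewrite fimfunE -fsumEFin// ge0_mule_fsuml; last first.
      by move=> x; rewrite EFinM nnfun_muleindic_ge0.
    over.
  rewrite ge0_integral_fsum//; last 2 first.
  - move=> x; apply: emeasurable_funM; last exact: measurable_funTS.
    by apply/measurable_EFinP; exact: measurable_funM.
  - by move=> x w _; rewrite mule_ge0 ?lee_fin// -lee_fin EFinM nnfun_muleindic_ge0.
  apply: lee_fsum => // x [z _ fz].
  have x0 : (0 <= x)%R by rewrite -fz.
  under eq_integral => w _ do rewrite EFinM -muleA.
  rewrite ge0_integralZl_EFin//; last 2 first.
  - by move=> w _; rewrite mule_ge0 ?lee_fin.
  - by apply: emeasurable_funM; [exact/measurable_EFinP|exact: measurable_funTS].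
  rewrite muleCA; apply: lee_wpmul2l; first by rewrite lee_fin.
  have FA := stopped_preimage filt st (mB x).
  have eg0 p : 0 <= (EFin \o g) p by rewrite lee_fin.
  have meg : measurable_fun [set: paths R] (EFin \o g) by exact/measurable_EFinP.
  have HKw w (_ : (D `&` (fun w => fine (S w)) @^-1` (f n @^-1` [set x])) w) (_ : S w < +oo) :
      path_mean (Y (fine (S w)) w) (EFin \o g) <= K%:E.
    apply: HK; apply: (markov_state_space markov).
    exact: fine_stopping_ge0 st.
  have := strong_markov_le Iy st FA meg eg0 K0 HKw.
  rewrite -/D setIAC setIid; apply: le_trans.
  rewrite integral_mkcondr.
  rewrite le_eqVlt; apply/orP; left; apply/eqP.
  apply: eq_integral => w _ /=; rewrite patchE indicE.
  by case: ifPn => [/set_mem wB|/negP wB]; [rewrite mem_set// mul1e|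
    rewrite memNset ?mul0e// => wB'; apply: wB; exact: mem_set].
have c1 : \int[P y]_(w in D) ((f n (fine (S w)))%:E * (g (after Y S w))%:E) @[n --> \oo] -->
   \int[P y]_(w in D) ((phi (fine (S w)))%:E * (g (after Y S w))%:E).
  have cf x : (f n x)%:E @[n --> \oo] --> (phi x)%:E.
    exact: cvg_nnsfun_approx.
  rewrite [X in _ --> X](_ : _ = \int[P y]_(w in D) limn (fun n =>
      (f n (fine (S w)))%:E * (g (after Y S w))%:E)); last first.
    apply: eq_integral => w _; apply/esym/cvg_lim => //.
    by apply: cvgeZr => //; exact: cf.
  apply: cvg_monotone_convergence => //.
  - move=> n; apply: emeasurable_funM; last exact: measurable_funTS.
    by apply/measurable_EFinP; apply: measurable_funTS; exact: measurableT_comp mf.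
  - by move=> n w _; rewrite mule_ge0 ?lee_fin.
  - move=> w _ n m nm; apply: lee_wpmul2r; first by rewrite lee_fin.
    by rewrite lee_fin; exact/lefP/nd_nnsfun_approx.
have c2 : (K%:E * \int[P y]_(w in D) (f n (fine (S w)))%:E) @[n --> \oo] -->
   K%:E * \int[P y]_(w in D) (phi (fine (S w)))%:E.
  by apply: cvgeZl => //; exact: (@integral_approx_comp _ _ _ _ _ (P y) D _ mD mf).
by apply: (lee_cvg_to c1 c2); exact: nearW.
Qed.

End strong_markov.

(** * Exponential and integral estimates *)

Lemma expR_le_quadratic (R : realType) (x : R) :
  (expR x <= 1 + x + x ^+ 2 * expR `|x|)%R.
Proof.
have [x0|x0] := leP 0%R x.
  rewrite ger0_norm//; have [x1|x1] := leP 1%R x.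
    have : (1 * expR x <= x ^+ 2 * expR x)%R.
      by rewrite ler_wpM2r ?expR_ge0// expr_ge1.
    by lra.
  have e1 : (expR x * (1 - x) <= 1)%R.
    rewrite -[leRHS](mulfV (lt0r_neq0 (expR_gt0 x))).
    rewrite ler_wpM2l ?expR_ge0// -expRN.
    exact: expR_ge1Dx.
  have : (expR x * (1 - x) * (1 + x) <= 1 * (1 + x))%R.
    by rewrite ler_wpM2r//; lra.
  by nra.
set y := (- x)%R; have y0 : (0 < y)%R by rewrite oppr_gt0.
rewrite ltr0_norm// -/y.
have ey : (1 + y <= expR y)%R by exact: expR_ge1Dx.
have -> : x = (- y)%R by rewrite opprK.
rewrite expRN sqrrN.
have e1 : ((expR y)^-1 <= (1 + y)^-1)%R.
  by rewrite lef_pV2 ?posrE ?expR_gt0//; lra.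
have e2 : ((1 + y)^-1 <= 1 - y + y ^+ 2)%R.
  rewrite -[leRHS]mulr1 -ler_pdivrMl; last by nra.
  rewrite -invfM invf_le1; last by nra.
  have -> : ((1 - y + y ^+ 2) * (1 + y) = 1 + y ^+ 3)%R by ring.
  by rewrite lerDl exprn_ge0 ?ltW.
have : (y ^+ 2 * 1 <= y ^+ 2 * expR y)%R.
  by rewrite ler_wpM2l ?sqr_ge0//; lra.
by lra.
Qed.

Lemma sqr_le_expR (R : realType) (z : R) : (0 <= z)%R ->
  (z ^+ 2 <= 4 * expR z)%R.
Proof.
move=> z0; have -> : z = (z / 2 + z / 2)%R by field.
rewrite expRD; have := expR_ge1Dx (z / 2)%R; set e := expR _ => he.
have : ((1 + z / 2) * (1 + z / 2) <= e * e)%R by rewrite ler_pM//; lra.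
by nra.
Qed.

(** The quadratic remainder of exp (theta f) absorbed into an exponential of
    rate lam: with z = lam |f| / 2 >= |theta f|, both z^2 / 4 and exp |theta f|
    are at most e^z. *)
Lemma expR_le_affine_exp (R : realType) (lam theta f : R) :
  (0 < lam)%R -> (`|theta| <= lam / 2)%R ->
  (expR (theta * f) <= 1 + theta * f
     + 16 / lam ^+ 2 * theta ^+ 2 * expR (lam * `|f|))%R.
Proof.
move=> lam0 th; apply: le_trans (expR_le_quadratic _) _; rewrite lerD2l.
set z := (lam * `|f| / 2)%R; have z0 : (0 <= z)%R.
  by rewrite /z divr_ge0// mulr_ge0// ltW.
have xz : (`|theta * f| <= z)%R.
  rewrite normrM /z mulrAC; exact: ler_wpM2r.
have -> : (lam * `|f| = z + z)%R by rewrite /z; field.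
rewrite expRD mulrA; apply: ler_pM; rewrite ?sqr_ge0 ?expR_ge0//.
  have zE : (f ^+ 2 = 4 / lam ^+ 2 * z ^+ 2)%R.
    rewrite /z -(real_normK (num_real f)); field; exact: lt0r_neq0.
  rewrite exprMn zE.
  have -> : (theta ^+ 2 * (4 / lam ^+ 2 * z ^+ 2) = (4 / lam ^+ 2 * theta ^+ 2) * z ^+ 2)%R by ring.
  have -> : (16 / lam ^+ 2 * theta ^+ 2 * expR z = (4 / lam ^+ 2 * theta ^+ 2) * (4 * expR z))%R by ring.
  apply: ler_wpM2l; last exact: sqr_le_expR.
  by rewrite mulr_ge0 ?sqr_ge0// divr_ge0 ?sqr_ge0.
by rewrite ler_expR.
Qed.

Section integral_bounds.
Context d (T : measurableType d) (R : realType).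

(** Fatou's lemma for a bound that holds along the whole sequence. *)
Lemma integral_le_of_limn_einf (mu : {measure set T -> \bar R}) (D : set T)
    (f : T -> \bar R) (f_ : (T -> \bar R)^nat) (K : \bar R) :
  measurable D -> measurable_fun D f -> (forall n, measurable_fun D (f_ n)) ->
  (forall x, D x -> 0 <= f x) ->
  (forall n x, D x -> 0 <= f_ n x) ->
  (forall x, D x -> f x <= limn_einf (f_ ^~ x)) ->
  (forall n, \int[mu]_(x in D) f_ n x <= K) ->
  \int[mu]_(x in D) f x <= K.
Proof.
move=> mD mf mf_ f0 f_0 ff_ fK.
apply: (@le_trans _ _ (\int[mu]_(x in D) limn_einf (f_ ^~ x))).
  apply: ge0_le_integral => //.
  apply: measurableT_comp => //; apply: measurable_fun_limn_esup => n.
  exact: measurableT_comp.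
apply: le_trans (fatou mu mD mf_ f_0) _.
rewrite limn_einf_lim; apply: lime_le; first exact: is_cvg_einfs.
by apply: nearW => n; apply: le_trans (fK n); apply: ereal_inf_lbound; exists n => /=.
Qed.

Lemma limn_einf_ge_near (u : (\bar R)^nat) (x : \bar R) :
  (\forall n \near \oo, x <= u n) -> x <= limn_einf u.
Proof.
move=> [N _ HN]; rewrite limn_einf_lim; apply: lime_ge; first exact: is_cvg_einfs.
exists N => // n /= Nn; apply: le_ereal_inf_tmp => _ [k /= nk <-].
by apply: HN => /=; exact: leq_trans nk.
Qed.

(** Mean close to 0 together with one exponential moment controls the
    moment generating function to second order. *)
Lemma exp_moment_le (P : probability T R) (f : T -> R) (lam B dlt mean theta : R) :
  measurable_fun [set: T] f -> (0 < lam)%R ->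
  \int[P]_x (expR (lam * `|f x|))%:E <= B%:E ->
  \int[P]_x (f x)%:E = mean%:E -> (`|mean| <= dlt)%R ->
  (`|theta| <= lam / 2)%R ->
  \int[P]_x (expR (theta * f x))%:E <=
    (1 + `|theta| * dlt + 16 / lam ^+ 2 * theta ^+ 2 * B)%:E.
Proof.
move=> mf lam0 HB fm mdlt th.
have mabs : measurable_fun [set: T] (fun x => lam * `|f x|)%R.
  by apply: measurable_funM => //; exact: measurableT_comp.
have mexp : measurable_fun [set: T] (fun x => (expR (lam * `|f x|))%:E).
  by apply/measurable_EFinP; exact: (measurableT_comp (@measurable_expR R) mabs).
have iexp : P.-integrable [set: T] (fun x => (expR (lam * `|f x|))%:E).
  apply/integrableP; split => //.
  under eq_integral => x _ do rewrite gee0_abs ?lee_fin ?expR_ge0//.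
  by apply: le_lt_trans HB _; rewrite ltry.
have if_ : P.-integrable [set: T] (fun x => (f x)%:E).
  have := integrableZl measurableT lam^-1 iexp.
  apply: le_integrable => //; first exact/measurable_EFinP.
  move=> x _ /=; rewrite lee_fin [leRHS]ger0_norm; last first.
    by rewrite mulr_ge0 ?expR_ge0// invr_ge0 ltW.
  rewrite ler_pdivlMl//; apply: le_trans (expR_ge1Dx _).
  by rewrite lerDr.
set k := (16 / lam ^+ 2 * theta ^+ 2)%R.
have k0 : (0 <= k)%R by rewrite mulr_ge0 ?sqr_ge0// divr_ge0 ?sqr_ge0.
pose g x : \bar R := 1 + theta%:E * (f x)%:E + k%:E * (expR (lam * `|f x|))%:E.
have i1 : P.-integrable [set: T] (fun=> 1 : \bar R).
  exact: finite_measure_integrable_cst.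
have i2 := integrableZl measurableT theta if_.
have i12 := integrableD measurableT i1 i2.
have i3 := integrableZl measurableT k iexp.
apply: (@le_trans _ _ (\int[P]_x g x)).
  apply: ge0_le_integral => //.
  - apply/measurable_EFinP; apply: (measurableT_comp (@measurable_expR R)).
    exact: measurable_funM.
  - have := integrableD measurableT i12 i3.
    by move/measurable_int.
  - by move=> x _; rewrite /g -!EFinM -!EFinD lee_fin expR_le_affine_exp.
have -> : \int[P]_x g x = (1 + theta * mean)%:E + k%:E * \int[P]_x (expR (lam * `|f x|))%:E.
  rewrite (integralD measurableT i12 i3) (integralD measurableT i1 i2).
  rewrite (integralZl measurableT if_) (integralZl measurableT iexp).
  have h1 := integral_cst P measurableT 1; rewrite /= probability_setT mule1 in h1.
  by rewrite fm h1.
apply: (@le_trans _ _ ((1 + theta * mean)%:E + k%:E * B%:E)).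
  by rewrite leeD2l// lee_wpmul2l// lee_fin.
rewrite -EFinM -EFinD lee_fin lerD2r lerD2l.
apply: le_trans (ler_norm _) _; rewrite normrM.
exact: ler_wpM2l.
Qed.

End integral_bounds.

(** * Exit times of an interval *)

Section exit_paths.
Context (R : realType).
Implicit Types (b s : R) (p : R -> R).

Lemma hit_shift b p s : (0 <= s)%R -> s%:E < hit (fun=> b) p ->
  hit (fun=> b) p = s%:E + hit (fun=> b) (fun t => p (s + t)%R).
Proof.
move=> s0 sh; apply/eqP; rewrite eq_le; apply/andP; split.
  rewrite -leeBlDl//; apply: le_ereal_inf_tmp => _ [t [t0 pt] <-].
  rewrite leeBlDl// -EFinD; apply: ereal_inf_lbound.
  by exists (s + t)%R => //; split => //; exact: addr_ge0.
apply: le_ereal_inf_tmp => _ [t [t0 pt] <-].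
have st : (s <= t)%R.
  rewrite -lee_fin ltW// (lt_le_trans sh)//.
  by apply: ereal_inf_lbound; exists t.
rewrite -leeBrDl// -EFinB; apply: ereal_inf_lbound.
by exists (t - s)%R => //; split; rewrite ?subr_ge0// addrC subrK.
Qed.

Definition hit_either b1 b2 p : \bar R :=
  Order.min (hit (fun=> b1) p) (hit (fun=> b2) p).

Definition rational_hit_either b1 b2 p : \bar R :=
  Order.min (rational_hit (fun=> b1) p) (rational_hit (fun=> b2) p).

Lemma rational_hit_eitherE b1 b2 p : continuous_path p -> rational_hit_either b1 b2 p = hit_either b1 b2 p.
Proof. by move=> cp; rewrite /rational_hit_either /hit_either !rational_hitE. Qed.

Lemma measurable_rational_hit_either b1 b2 :
  measurable_fun [set: paths R] (rational_hit_either b1 b2 : paths R -> \bar R).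
Proof.
by apply: measurable_mine; apply: measurable_rational_hit; exact: measurable_cst.
Qed.

Lemma hit_either_ge0 b1 b2 p : 0 <= hit_either b1 b2 p.
Proof. by rewrite /hit_either le_min !hit_ge0. Qed.

Lemma hit_either_shift b1 b2 p s : (0 <= s)%R -> s%:E < hit_either b1 b2 p ->
  hit_either b1 b2 p = s%:E + hit_either b1 b2 (fun t => p (s + t)%R).
Proof.
move=> s0; rewrite /hit_either lt_min => /andP[s1 s2].
rewrite (hit_shift s0 s1) (hit_shift s0 s2).
set x := hit _ _; set y := hit _ _.
have [xy|yx] := leP x y; first by rewrite (min_idPl _)// leeD2l.
by rewrite (min_idPr _)// leeD2l// ltW.
Qed.

Lemma hit_either_stop b1 b2 p u : continuous_path p -> (0 <= u)%R ->
  (hit_either b1 b2 (fun t => p (Num.min t u)) <= u%:E) = (hit_either b1 b2 p <= u%:E).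
Proof.
move=> cp u0; rewrite /hit_either !hit_stop// !ge_min.
by case: ifPn => Hu; case: ifPn => Hd; rewrite ?(negbTE Hu) ?(negbTE Hd) ?Hu ?Hd.
Qed.

(** By the intermediate value theorem. *)
Lemma between_before_exit b1 b2 p s : continuous_path p -> (0 <= s)%R ->
  (b1 < p 0%R < b2)%R -> s%:E < hit_either b1 b2 p -> (b1 < p s < b2)%R.
Proof.
move=> cp s0 /andP[p1 p2]; rewrite /hit_either lt_min => /andP[s1 s2].
have cps : {within `[0%R, s]%classic, continuous p}.
  by apply: continuous_subspaceW cp => t /=; rewrite in_itv/= => /andP[].
have nohit b : s%:E < hit (fun=> b) p -> forall t, t \in `[0%R, s] -> p t <> b.
  move=> sb t; rewrite in_itv /= => /andP[t0 ts] pt.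
  have : hit (fun=> b) p <= t%:E by apply: ereal_inf_lbound; exists t.
  by move/(lt_le_trans sb); rewrite lte_fin ltNge ts.
apply/andP; split; rewrite ltNge; apply/negP => ps.
  have [|t ts pt] := @IVT _ p 0%R s b1 s0 cps.
    by rewrite ge_min le_max ps (ltW p1) orbT.
  exact: nohit s1 _ ts pt.
have [|t ts pt] := @IVT _ p 0%R s b2 s0 cps.
  by rewrite ge_min le_max ps (ltW p2) orbT.
exact: nohit s2 _ ts pt.
Qed.

End exit_paths.

Lemma hitting_timeE d (T : measurableType d) (R : realType) (Y : R -> T -> R) (b : R) w :
  hitting_time Y b%:E w = hit (fun=> b) (traj Y w).
Proof.
rewrite /hitting_time /hit; congr ereal_inf; congr image.
by apply/seteqP; split => t /= [t0 Yt]; split => //; [case: Yt|rewrite -Yt].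
Qed.

Section exit_moments.
Context d (R : realType) (Omega : measurableType d) (I : set R)
  (F : R -> set (set Omega)) (P : R -> probability Omega R)
  (Y : R -> Omega -> R).
Hypothesis mI : measurable I.
Hypothesis markov : continuous_strong_markov I F P Y.

Let filt := markov_filtration markov.
Let adapted := markov_adapted markov.
Let contY : forall w, continuous_path (Y ^~ w) := markov_continuous markov.

(** Levels that depend on the starting point are thereby constant, almost
    surely. *)
Lemma start_ae z : I z -> {ae P z, forall w, Y 0%R w = z}.
Proof.
move=> Iz; have m0 : measurable [set w | Y 0%R w = z].
  have := process_measurable filt adapted (lexx 0%R).
  by move=> /(_ measurableT _ (measurable_set1 z)); rewrite setTI.
exists (~` [set w | Y 0%R w = z]); split; first exact: measurableC.
  rewrite probability_setC// (markov_start markov Iz).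
  by rewrite subee.
by move=> w.
Qed.

Lemma continuous_traj w : continuous_path (traj Y w).
Proof. exact: contY. Qed.

Lemma measurable_hit_either b1 b2 :
  measurable_fun [set: Omega] (fun w => hit_either b1 b2 (traj Y w)).
Proof.
have := measurableT_comp (measurable_rational_hit_either b1 b2) (measurable_traj markov).
congr (measurable_fun _ _); apply/funext => w /=.
by rewrite rational_hit_eitherE//; exact: continuous_traj.
Qed.

Lemma exit_stopping b1 b2 : stopping_time F (fun w => hit_either b1 b2 (traj Y w)).
Proof.
have := stopping_time_add filt adapted contY (stopping_time_cst filt (lexx 0%R))
  (@hit_either_ge0 R b1 b2) (measurable_rational_hit_either b1 b2) (@rational_hit_eitherE R b1 b2) (@hit_either_stop R b1 b2).
congr (stopping_time _ _); apply/funext => w; rewrite add0e; congr hit_either.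
by apply/funext => t; rewrite /after /= add0r.
Qed.

(** The event on which the Markov property at time s is applied. It contains
    the condition on Y 0 because a path that has not hit b1 or b2 lies between
    them only if it started there. *)
Lemma before_exit_stopped (b1 b2 s z : R) : (0 <= s)%R ->
  stopped_sigma_algebra F (fun=> s%:E)
    ([set w | Y 0%R w = z] `&` [set w | s%:E < hit_either b1 b2 (traj Y w)]).
Proof.
move=> s0.
have FA : F s ([set w | Y 0%R w = z] `&` [set w | s%:E < hit_either b1 b2 (traj Y w)]).
  have -> : [set w | s%:E < hit_either b1 b2 (traj Y w)] =
      ~` [set w | hit_either b1 b2 (traj Y w) <= s%:E].
    by apply/seteqP; split => w /=; rewrite ltNge => /negP.
  rewrite -(filtration_measurableE filt _ s0); apply: measurableI.
    rewrite (filtration_measurableE filt)//.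
    apply: (filtration_nondecreasing filt (lexx 0%R) s0).
    exact: adapted (measurable_set1 z).
  apply: measurableC; rewrite (filtration_measurableE filt)//.
  exact: (exit_stopping b1 b2).2.
split; first exact: (filtration_measurable filt s0 FA).
move=> t t0; have [st|ts] := leP s t.
  rewrite (_ : [set w | s%:E <= t%:E] = setT) ?setIT; last first.
    by apply/seteqP; split => w //= _; rewrite lee_fin.
  exact: (filtration_nondecreasing filt s0 st).
rewrite (_ : [set w | s%:E <= t%:E] = set0) ?setI0; last first.
  by apply/seteqP; split => w //=; rewrite lee_fin leNgt ts.
by rewrite -(filtration_measurableE filt _ t0); exact: measurable0.
Qed.

Section geometric_tail.
Variables (b1 b2 s mu : R).
Hypotheses (s0 : (0 < s)%R) (mu0 : (0 < mu)%R) (mus : (expR (mu * s) <= 3 / 2)%R).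
Hypothesis bI : forall z, (b1 < z < b2)%R -> I z.
Hypothesis mean_exit : forall z, (b1 < z < b2)%R ->
  \int[P z]_w hit_either b1 b2 (traj Y w) <= (s / 2)%:E.

(** Markov's inequality. *)
Lemma prob_late_exit z : (b1 < z < b2)%R ->
  P z [set w | s%:E < hit_either b1 b2 (traj Y w)] <= (1 / 2)%:E.
Proof.
move=> zb; have mH := measurable_hit_either b1 b2.
have m1 : measurable [set w | s%:E < hit_either b1 b2 (traj Y w)].
  by rewrite -[X in measurable X]setTI; exact: emeasurable_fun_o_infty.
have := le_integral_abse (P z) measurableT mH s0.
under eq_integral => w _ do rewrite gee0_abs ?hit_either_ge0//.
move=> /le_trans/(_ (mean_exit zb)) H.
rewrite -(@lee_pmul2l _ s%:E)//; apply: (@le_trans _ _ (s / 2)%:E); last first.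
  by rewrite -EFinM lee_fin; lra.
apply: le_trans H; rewrite lee_pmul2l//; apply: le_measure; rewrite ?inE//.
  apply: emeasurable_fun_c_infty => //; exact: measurableT_comp.
by move=> w /= /ltW; rewrite gee0_abs ?hit_either_ge0.
Qed.

Let G (n : nat) (p : paths R) : R :=
  expR (mu * fine (Order.min (rational_hit_either b1 b2 p) (n%:R * s)%:E)).

Lemma measurable_truncated_exp n : measurable_fun [set: paths R] (EFin \o G n).
Proof.
apply/measurable_EFinP; apply: (measurableT_comp (@measurable_expR R)).
apply: measurable_funM => //; apply: measurableT_comp => //.
by apply: measurable_mine => //; exact: measurable_rational_hit_either.
Qed.

(** A path still inside the interval at time s starts afresh from an inner
    point, and this happens with probability at most 1/2. So a bound u for the
    truncation at n s becomes 3/2 (1 + u / 2) for the truncation at (n + 1) s,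
    and 6 is the fixed point of this recursion. The truncation keeps the
    moments finite. *)
Lemma truncated_exit_exp_moment n z : (b1 < z < b2)%R ->
  path_mean P Y z (EFin \o G n) <= 6%:E.
Proof.
elim: n z => [|n IH] z zb.
  rewrite /path_mean; under eq_integral => w _.
    rewrite /= /G rational_hit_eitherE; last exact: continuous_traj.
    rewrite mul0r (min_idPr _) ?hit_either_ge0// /= mulr0 expR0.
    over.
  have := integral_cst (P z) measurableT 1; rewrite /= probability_setT mule1 => ->.
  by rewrite lee_fin; lra.
pose S : Omega -> \bar R := fun=> s%:E.
have st : stopping_time F S by apply: stopping_time_cst => //; exact: ltW.
pose A := [set w | Y 0%R w = z] `&` [set w | s%:E < hit_either b1 b2 (traj Y w)].
have FA : stopped_sigma_algebra F S A by apply: before_exit_stopped; exact: ltW.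
have mA : measurable A by case: FA.
have mX : measurable_fun [set: Omega] (after Y S : Omega -> paths R).
  exact: (measurable_after filt adapted contY).
have mGX : measurable_fun [set: Omega] (fun w => (G n (after Y S w))%:E).
  exact: (measurableT_comp (measurable_truncated_exp n) mX).
pose g := (fun w => (G n (after Y S w))%:E) \_ A.
have mg : measurable_fun [set: Omega] g.
  by apply/(measurable_restrictT _ mA); exact: measurable_funTS.
have g0 w : 0 <= g w.
  by rewrite /g patchE; case: ifPn => // _; rewrite lee_fin expR_ge0.
have step1 : path_mean P Y z (EFin \o G n.+1) <= \int[P z]_w ((3 / 2)%:E * (1 + g w)).
  apply: ae_ge0_le_integral => //.
  - by move=> w _; rewrite lee_fin expR_ge0.
  - exact: (measurableT_comp (measurable_truncated_exp n.+1) (measurable_traj markov)).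
  - by move=> w _; rewrite mule_ge0// ?lee_fin// adde_ge0.
  - by apply: emeasurable_funM => //; exact: emeasurable_funD.
  have := start_ae (bI zb); apply: filterS => w Yz _.
  rewrite /= /G rational_hit_eitherE; last exact: continuous_traj.
  have [sH|Hs] := ltP s%:E (hit_either b1 b2 (traj Y w)); last first.
    apply: (@le_trans _ _ (3 / 2)%:E).
      rewrite lee_fin; apply: le_trans mus; rewrite ler_expR.
      apply: ler_wpM2l; first exact: ltW.
      have h0 := hit_either_ge0 b1 b2 (traj Y w).
      rewrite -lee_fin fineK.
        by rewrite ge_min Hs.
      rewrite ge0_fin_numE; last by rewrite le_min h0 lee_fin mulr_ge0// ltW.
      by rewrite gt_min (le_lt_trans Hs)// ltry.
    by rewrite -[leLHS]mule1 lee_pmul2l// ?lte_fin// leeDl.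
  have -> : g w = (G n (after Y S w))%:E by rewrite /g patchE mem_set.
  rewrite (hit_either_shift (ltW s0) sH) /G rational_hit_eitherE; last exact: (continuous_after contY st).
  have -> : (fun t => traj Y w (s + t)%R) = after Y S w by [].
  set e := hit_either b1 b2 _.
  have e0 : 0 <= e by exact: hit_either_ge0.
  have ns0 : (0 <= n%:R * s)%R by rewrite mulr_ge0// ltW.
  have eF : (fine (Order.min e (n%:R * s)%:E))%:E = Order.min e (n%:R * s)%:E.
    exact: fine_mineK.
  have -> : fine (Order.min (s%:E + e) (n.+1%:R * s)%:E) =
      (s + fine (Order.min e (n%:R * s)%:E))%R.
    apply: EFin_inj; rewrite EFinD eF fineK; last first.
      rewrite ge0_fin_numE ?gt_min ?ltry ?orbT//.
      by rewrite le_min adde_ge0// lee_fin ?mulr_ge0// ltW.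
    rewrite -natr1 mulrDl mul1r [(n%:R * s + s)%R]addrC EFinD.
    have [xy|yx] := leP e (n%:R * s)%:E; last first.
      by rewrite (min_idPr _)// leeD2l// ltW.
    by rewrite (min_idPl _)// leeD2l.
  rewrite mulrDr expRD EFinM; apply: lee_pmul => //; rewrite ?lee_fin ?expR_ge0//.
  by rewrite -?EFinD ?lee_fin lerDr.
apply: (le_trans step1); rewrite ge0_integralZl_EFin//; last 2 first.
- by move=> w _; rewrite adde_ge0.
- exact: emeasurable_funD.
rewrite ge0_integralD//.
have := integral_cst (P z) measurableT 1; rewrite /= probability_setT mule1 => ->.
rewrite /g -integral_mkcond.
have HA w (Aw : A w) (_ : S w < +oo) : path_mean P Y (Y (fine (S w)) w) (EFin \o G n) <= 6%:E.
  apply: IH; move: Aw => [Yz sH]; have := between_before_exit (@continuous_traj w) (ltW s0) _ sH.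
  by apply; rewrite /traj Yz.
have G0 p : 0 <= (EFin \o G n) p by rewrite lee_fin expR_ge0.
have := strong_markov_le mI markov (bI zb) st FA (measurable_truncated_exp n) G0 (ler0n _ 6) HA.
have -> : A `&` [set w | S w < +oo] = A.
  by apply/seteqP; split => w //=; [case|move=> ?; split => //; rewrite ltry].
move=> H6.
have PA : P z A <= (1 / 2)%:E.
  apply: le_trans (prob_late_exit zb); apply: le_measure; rewrite ?inE//.
    by rewrite -[X in measurable X]setTI; apply: emeasurable_fun_o_infty => //; exact: measurable_hit_either.
  by move=> w [].
apply: (@le_trans _ _ ((3 / 2)%:E * (1 + 6%:E * (1 / 2)%:E))).
  rewrite lee_pmul2l//; apply: leeD => //; apply: le_trans H6 _.
  by rewrite lee_pmul2l.
have -> : 6%:E * (1 / 2)%:E = 3%:E :> \bar R by rewrite -EFinM; congr EFin; lra.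
have -> : 1 + 3%:E = 4%:E :> \bar R by rewrite -(EFinD 1%R); congr EFin; lra.
by rewrite -EFinM lee_fin; lra.
Qed.

Lemma exit_exp_moment z : (b1 < z < b2)%R ->
  \int[P z]_w (expR (mu * fine (hit_either b1 b2 (traj Y w))))%:E <= 6%:E.
Proof.
move=> zb.
apply: (@integral_le_of_limn_einf _ _ _ _ _ _ (fun n w => (G n (traj Y w))%:E)) => //.
- apply/measurable_EFinP; apply: (measurableT_comp (@measurable_expR R)).
  apply: measurable_funM => //; apply: measurableT_comp => //; exact: measurable_hit_either.
- move=> n; exact: (measurableT_comp (measurable_truncated_exp n) (measurable_traj markov)).
- by move=> n w _; rewrite lee_fin expR_ge0.
- move=> w _; apply: limn_einf_ge_near.
  have [N HN] : exists N, hit_either b1 b2 (traj Y w) = +oo \/ hit_either b1 b2 (traj Y w) <= (N%:R * s)%:E.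
    have := hit_either_ge0 b1 b2 (traj Y w).
    case: (hit_either _ _ _) => [e| |] // e0; last by exists 0%N; left.
    exists (Num.truncn (e / s)).+1; right; rewrite lee_fin -ler_pdivrMr//.
    exact/ltW/truncnS_gt.
  exists N => // n /= Nn; rewrite lee_fin ler_expR.
  apply: ler_wpM2l; first exact: ltW.
  rewrite rational_hit_eitherE; last exact: continuous_traj.
  have ns0 : (0 <= n%:R * s)%R by rewrite mulr_ge0// ltW.
  case: HN => [->|HN]; first by rewrite (min_idPr _) ?leey.
  rewrite (min_idPl _)//; apply: le_trans HN _.
  by rewrite lee_fin ler_pM2r// ler_nat.
- by move=> n; exact: truncated_exit_exp_moment.
Qed.

End geometric_tail.

End exit_moments.

(** * One step from a point of the interior *)

Lemma measurable_interior_of (R : realType) (l r : \bar R) :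
  measurable (interior_of l r).
Proof.
rewrite (_ : interior_of l r = EFin @^-1` `]l, r[%classic); last first.
  by apply/seteqP; split => x /=; rewrite in_itv /=.
rewrite -[X in measurable X]setTI.
have : measurable_fun [set: R] (@EFin R) by exact/measurable_EFinP.
by apply => //; exact: emeasurable_itv.
Qed.

(** There are at most two boundary points. *)
Lemma measurable_boundary (R : realType) (l r : \bar R) (J : set R) :
  J `<=` is_boundary l r -> measurable J.
Proof.
move=> Jb; apply: countable_measurable => //.
apply: finite_set_countable; apply: (@sub_finite_set _ _ [set fine l; fine r]).
  by move=> x /Jb [] /= <-; [left|right].
exact: finite_set2.
Qed.

Lemma closure_caseP (R : realType) (l r : \bar R) (x : R) :
  l <= x%:E <= r -> interior_of l r x \/ is_boundary l r x.
Proof.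
move=> /andP[]; rewrite le_eqVlt => /predU1P[lx|lx]; first by right; left.
rewrite le_eqVlt => /predU1P[xr|xr]; first by right; right.
by left; apply/andP.
Qed.

Lemma sub_closure_measurable (R : realType) (I : set R) (l r : \bar R) :
  interior_of l r `<=` I -> I `<=` [set x | l <= x%:E <= r] -> measurable I.
Proof.
move=> sI Is.
have -> : I = interior_of l r `|` (I `&` is_boundary l r).
  apply/seteqP; split => x /=.
    by move=> Ix; case: (closure_caseP (Is x Ix)) => ?; [left|right].
  by case=> [/sI|[]].
apply: measurableU; first exact: measurable_interior_of.
by apply: (@measurable_boundary _ l r) => x [].
Qed.

(** The Green function of the interval with pole z is at most the distance
    from u to the nearer end, which is twice the Green function with its pole
    at the centre. *)
Lemma green_le_tent (R : realType) (v a z u : R) : (0 < a)%R ->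
  (v - a < z < v + a)%R -> (v - a < u < v + a)%R ->
  (0 <= ((v + a) - Num.max z u) * (Num.min z u - (v - a)) / ((v + a) - (v - a))
     <= a - `|u - v|)%R.
Proof.
move=> a0 /andP[z1 z2] /andP[u1 u2].
have -> : ((v + a) - (v - a) = 2 * a)%R by ring.
have a2 : (0 < 2 * a)%R by rewrite mulr_gt0.
apply/andP; split.
  apply: divr_ge0; last exact: ltW.
  apply: mulr_ge0; rewrite subr_ge0.
    by rewrite ge_max (ltW z2) (ltW u2).
  by rewrite le_min (ltW z1) (ltW u1).
rewrite ler_pdivrMr//.
have [uv|vu] := leP v u.
  rewrite ger0_norm ?subr_ge0//.
  case: (leP z u) => zu; nra.
rewrite ltr0_norm ?subr_lt0//.
case: (leP z u) => zu; nra.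
Qed.

Lemma green_center (R : realType) (v a u : R) : (0 < a)%R ->
  (v - a < u < v + a)%R ->
  (((v + a) - Num.max v u) * (Num.min v u - (v - a)) / ((v + a) - (v - a))
     = 2^-1 * (a - `|u - v|))%R.
Proof.
move=> a0 /andP[u1 u2].
have -> : ((v + a) - (v - a) = 2 * a)%R by ring.
have [vu|uv] := leP v u.
  rewrite ger0_norm ?subr_ge0//; field; exact: lt0r_neq0.
rewrite ltr0_norm ?subr_lt0//; field; exact: lt0r_neq0.
Qed.

(** For c <= 2 h the mean exit times are at most 4 h, so s = 8 h is admissible
    in exit_exp_moment; the rate exit_rate / h satisfies
    exp (rate * s) = 3 / 2. *)
Definition exit_rate (R : realType) : R := (ln (3 / 2) / 8)%R.
Arguments exit_rate : clear implicits.

Lemma exit_rate_gt0 (R : realType) : (0 < exit_rate R)%R.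
Proof. by rewrite /exit_rate divr_gt0// ln_gt0//; lra. Qed.

Section one_step.

Context d (R : realType) (Omega : measurableType d) (I : set R) (l r : \bar R)
  (F : R -> set (set Omega)) (P : R -> probability Omega R)
  (Y : R -> Omega -> R) (m : {measure set R -> \bar R}).
Hypothesis HY : general_diffusion I l r F P Y m.

Let markov := diffusion_markov HY.

Lemma state_space_measurable : measurable I.
Proof.
exact: sub_closure_measurable (diffusion_sub_interior HY) (diffusion_sub_closure HY).
Qed.

Lemma state_space_interval b1 b2 z : I b1 -> I b2 -> (b1 < z < b2)%R ->
  interior_of l r z.
Proof.
move=> /(diffusion_sub_closure HY)/= /andP[lb1 _].
move=> /(diffusion_sub_closure HY)/= /andP[_ b2r] /andP[z1 z2].
by apply/andP; split; [apply: le_lt_trans lb1 _|apply: lt_le_trans b2r]; rewrite lte_fin.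
Qed.

Section fixed_point.
Variables (v a : R).
Hypotheses (a0 : (0 < a)%R) (Il : I (v - a)%R) (Ir : I (v + a)%R).
Let b1 := (v - a)%R.
Let b2 := (v + a)%R.

Let bI z : (b1 < z < b2)%R -> I z.
Proof. by move/(state_space_interval Il Ir)/(diffusion_sub_interior HY). Qed.

Let b12 : (b1 < b2)%R.
Proof. by rewrite /b1 /b2 ltrBlDr -addrA ltrDl addr_gt0. Qed.

Let vb : (b1 < v < b2)%R.
Proof. by rewrite /b1 /b2 ltrBlDr ltrDl a0. Qed.

Lemma mean_exit_green z : (b1 < z < b2)%R ->
  \int[P z]_w hit_either b1 b2 (traj Y w) =
  \int[m]_(u in `]b1, b2[) ((b2 - Num.max z u) * (Num.min z u - b1) / (b2 - b1))%:E.
Proof.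
move=> /andP[z1 z2].
rewrite -(diffusion_speed HY Il Ir b12 (ltW z1) (ltW z2)).
by apply: eq_integral => w _; rewrite /hitting_time2 !hitting_timeE.
Qed.

Let measurable_tent : measurable_fun `]b1, b2[%classic (fun u => (a - `|u - v|)%:E).
Proof.
apply/measurable_EFinP; apply: measurable_funB => //.
by apply: measurableT_comp => //; apply: measurable_funB.
Qed.

(** This links the hypothesis on the scale factors, which is about tents, to
    the process. *)
Lemma mean_exit_center :
  \int[P v]_w hit_either b1 b2 (traj Y w) = half_tent_integral m v a.
Proof.
rewrite mean_exit_green// /half_tent_integral -ge0_integralZl_EFin//.
- by apply: eq_integral => u /set_mem /=; rewrite in_itv /= => ub; rewrite green_center.
- move=> u /=; rewrite in_itv /= lee_fin => ub.
  by have /andP[] := green_le_tent a0 vb ub => /le_trans; apply.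
Qed.

Lemma mean_exit_le z c : (b1 < z < b2)%R -> half_tent_integral m v a <= c%:E ->
  \int[P z]_w hit_either b1 b2 (traj Y w) <= (2 * c)%:E.
Proof.
move=> zb hc; rewrite mean_exit_green//.
apply: (@le_trans _ _ (\int[m]_(u in `]b1, b2[) (a - `|u - v|)%:E)).
  apply: ge0_le_integral => //.
  - move=> u /=; rewrite in_itv /= lee_fin => ub.
    by have /andP[] := green_le_tent a0 zb ub.
  - apply/measurable_EFinP; apply: measurable_funM => //.
    apply: measurable_funM; apply: measurable_funB => //.
      exact: measurable_maxr.
    exact: measurable_minr.
  - move=> u /=; rewrite in_itv /= lee_fin => ub.
    by have /andP[] := green_le_tent a0 zb ub.
rewrite EFinM -lee_pdivrMl//.
Qed.

Let Hx w := hit_either b1 b2 (traj Y w).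
Let up_first := [set w | hit (fun=> b2) (traj Y w) < hit (fun=> b1) (traj Y w)].

Lemma measurable_up_first : measurable up_first.
Proof.
have mh b : measurable_fun [set: Omega] (fun w => hit (fun=> b) (traj Y w)).
  have := measurableT_comp (measurable_rational_hit (@measurable_cst _ _ _ _ setT b)) (measurable_traj markov).
  congr (measurable_fun _ _); apply/funext => w /=.
  by rewrite rational_hitE//; exact: (continuous_traj markov).
rewrite -[up_first]setTI.
exact: emeasurable_fun_lt.
Qed.

Lemma up_first_prob : P v up_first = (1 / 2)%:E.
Proof.
have /andP[v1 v2] := vb.
have := diffusion_natural_scale HY Il Ir v1 v2.
have -> : [set w | hitting_time Y b2%:E w < hitting_time Y b1%:E w] = up_first.
  by apply/seteqP; split => w /=; rewrite !hitting_timeE.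
move=> ->; congr EFin; rewrite /b1 /b2.
have -> : (v + a - (v - a) = 2 * a)%R by ring.
have -> : (v - (v - a) = a)%R by ring.
by field; exact: lt0r_neq0.
Qed.

Section exit_law.
Variables (h c xu xd eps : R).
Hypotheses (h0 : (0 < h)%R) (hc : half_tent_integral m v a = c%:E)
  (c2h : (c <= 2 * h)%R) (xu0 : (0 <= xu <= 2 * h)%R) (xd0 : (0 <= xd <= 2 * h)%R)
  (hmean : (`|c + (xu + xd) / 2 - h| <= eps * h)%R).

Let f w : R := (fine (Hx w) + (xd - h) + (xu - xd) * \1_up_first w)%R.

Let mH : measurable_fun [set: Omega] Hx := measurable_hit_either markov b1 b2.

Let iH : (P v).-integrable [set: Omega] Hx.
Proof.
apply/integrableP; split => //.
under eq_integral => w _ do rewrite gee0_abs ?hit_either_ge0//.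
by rewrite mean_exit_center hc ltry.
Qed.

(** The exit time has the finite mean c. *)
Lemma exit_finite_ae : {ae P v, forall w, Hx w \is a fin_num}.
Proof. by have := integrable_ae measurableT iH; apply: filterS => w; apply. Qed.

Let m1 : measurable_fun [set: Omega] (fun w => \1_up_first w : R).
Proof. exact: measurable_indic measurable_up_first. Qed.

Let mf : measurable_fun [set: Omega] f.
Proof.
apply: measurable_funD; last exact: measurable_funM.
by apply: measurable_funD => //; exact: measurableT_comp.
Qed.

Let ifH : (P v).-integrable [set: Omega] (fun w => (fine (Hx w))%:E).
Proof.
apply: (@le_integrable _ _ _ _ _ measurableT _ Hx) => //.
  by apply/measurable_EFinP; exact: measurableT_comp.
move=> w _; have : 0 <= Hx w by exact: hit_either_ge0.
by case: (Hx w) => //= _; rewrite normr0 leey.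
Qed.

Let int_fine : \int[P v]_w (fine (Hx w))%:E = c%:E.
Proof.
rewrite -hc -mean_exit_center; apply: ae_eq_integral => //.
  by apply/measurable_EFinP; exact: measurableT_comp.
by have := exit_finite_ae; apply: filterS => w fH _; rewrite fineK.
Qed.

(** The two ends are reached first with probability 1/2 each. *)
Lemma step_mean : \int[P v]_w (f w)%:E = (c + (xu + xd) / 2 - h)%:E.
Proof.
have i1 : (P v).-integrable [set: Omega] (fun=> (xd - h)%:E).
  exact: finite_measure_integrable_cst.
have i2 : (P v).-integrable [set: Omega] (fun w => (\1_up_first w)%:E).
  exact: integrable_indic measurable_up_first.
have i3 := integrableZl measurableT (xu - xd)%R i2.
have i12 := integrableD measurableT ifH i1.
have -> : \int[P v]_w (f w)%:E = \int[P v]_w ((fine (Hx w))%:E + (xd - h)%:E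
    + (xu - xd)%:E * (\1_up_first w)%:E).
  by apply: eq_integral => w _; rewrite /f !EFinD EFinM.
rewrite (integralD measurableT i12 i3) (integralD measurableT ifH i1).
rewrite (integralZl measurableT i2) int_fine.
rewrite integral_indic// ?setIT ?up_first_prob; last exact: measurable_up_first.
have := integral_cst (P v) measurableT (xd - h)%:E; rewrite /= probability_setT mule1 => ->.
by rewrite up_first_prob -EFinM -!EFinD; congr EFin; field.
Qed.

(** The delays are at most 2 h, so the centred step differs in absolute value
    from the exit time by at most h. *)
Lemma step_exp_moment :
  \int[P v]_w (expR ((exit_rate R) / h * `|f w|))%:E <= (6 * expR (exit_rate R))%:E.
Proof.
have kh : (0 < (exit_rate R) / h)%R by rewrite divr_gt0// exit_rate_gt0.
have mE : measurable_fun [set: Omega] (fun w => (expR ((exit_rate R) / h * fine (Hx w)))%:E).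
  apply/measurable_EFinP; apply: (measurableT_comp (@measurable_expR R)).
  by apply: measurable_funM => //; exact: measurableT_comp.
apply: (@le_trans _ _ (\int[P v]_w ((expR (exit_rate R))%:E * (expR ((exit_rate R) / h * fine (Hx w)))%:E))).
  apply: ge0_le_integral => //.
  - apply/measurable_EFinP; apply: (measurableT_comp (@measurable_expR R)).
    by apply: measurable_funM => //; exact: measurableT_comp.
  - by apply: emeasurable_funM.
  - move=> w _; rewrite -EFinM lee_fin -expRD ler_expR.
    have kE : (exit_rate R) = ((exit_rate R) / h * h)%R by field; exact: lt0r_neq0.
    rewrite {2}kE -mulrDr ler_pM2l//.
    have H0 : (0 <= fine (Hx w))%R by apply: fine_ge0; exact: hit_either_ge0.
    rewrite /f indicE ler_norml.
    move: xu0 xd0 => /andP[u0 u2] /andP[e0 e2].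
    by case: (w \in up_first) => /=; rewrite ?mulr1 ?mulr0; lra.
rewrite ge0_integralZl_EFin ?expR_ge0//.
rewrite EFinM muleC; apply: lee_wpmul2r; first by rewrite lee_fin expR_ge0.
apply: (exit_exp_moment state_space_measurable markov (s := (8 * h)%R)) => //.
- by rewrite mulr_gt0.
- rewrite /exit_rate (_ : _ * _ = ln (3/2))%R ?lnK ?posrE//.
  by field; exact: lt0r_neq0.
- move=> z zb; have := mean_exit_le zb (c := c); rewrite hc lexx => /(_ isT) /le_trans; apply.
  by rewrite lee_fin; have := c2h; lra.
Qed.

Lemma step_exp_le theta : (`|theta| <= (exit_rate R) / h / 2)%R ->
  \int[P v]_w (expR (theta * f w))%:E <=
   (1 + `|theta| * (eps * h) + 16 / ((exit_rate R) / h) ^+ 2 * theta ^+ 2 * (6 * expR (exit_rate R)))%:E.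
Proof.
move=> th; apply: (exp_moment_le mf _ step_exp_moment step_mean hmean th).
by rewrite divr_gt0// exit_rate_gt0.
Qed.

End exit_law.

End fixed_point.

End one_step.

(** * Points whose exit interval touches the boundary *)

Section tents.
Context (R : realType) (m : {measure set R -> \bar R}).

Lemma tent_integral_le (v a h : R) : half_tent_integral m v a <= h%:E ->
  \int[m]_(u in `](v - a)%R, (v + a)%R[) (a - `|u - v|)%:E <= (2 * h)%:E.
Proof.
rewrite /half_tent_integral => H.
by rewrite EFinM -lee_pdivrMl.
Qed.

(** The bound at the infimum that defines l_h (s = 1) or r_h (s = -1): it is
    only known for smaller radii a', for which the interval keeps its left or
    its right end, and the tents converge pointwise as a' increases to a. *)
Lemma half_tent_le_limit (v a s h : R) : (0 < a)%R -> (`|s| <= 1)%R ->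
  (forall a', (0 < a' < a)%R ->
     half_tent_integral m (v + s * (a' - a))%R a' <= h%:E) ->
  half_tent_integral m v a <= h%:E.
Proof.
move=> a0 s1 H; rewrite /half_tent_integral.
rewrite lee_pdivrMl// -EFinM.
set D := `](v - a)%R, (v + a)%R[%classic.
(* half of a, so that already the first radius is positive *)
pose a_ n := (a - a / 2 * n.+1%:R^-1)%R.
pose v_ n := (v + s * (a_ n - a))%R.
have inv01 n : (0 < n.+1%:R^-1 :> R)%R /\ (n.+1%:R^-1 <= 1 :> R)%R.
  by rewrite invr_gt0 ltr0n; split => //; rewrite invf_le1 ?ltr0n// ler1n.
have a_01 n : (0 < a_ n < a)%R.
  rewrite /a_; move: (inv01 n); move: (n.+1%:R^-1)%R => i [i0 i1].
  have p0 := mulr_gt0 a0 i0; have p1 := ler_wpM2l (ltW a0) i1.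
  by apply/andP; split; lra.
have v_a n : (`|v_ n - v| <= a - a_ n)%R.
  have /andP[_ an] := a_01 n.
  rewrite /v_ addrC addKr normrM -[leRHS]mul1r; apply: ler_pM => //.
  by rewrite distrC ger0_norm// subr_ge0 ltW.
pose f_ n u := (Num.max 0 (a_ n - `|u - v_ n|))%R.
have mtent c b : measurable_fun [set: R] (fun u : R => c - `|u - b|)%R.
  apply: measurable_funB => //.
  by apply: measurableT_comp => //; apply: measurable_funB.
apply: (@integral_le_of_limn_einf _ _ _ _ _ _ (fun n u => (f_ n u)%:E)) => //.
- exact: measurable_itv.
- by apply/measurable_EFinP; apply: measurable_funTS; exact: mtent.
- move=> n; apply/measurable_EFinP; apply: measurable_funTS.
  by apply: measurable_maxr => //; exact: mtent.
- move=> u; rewrite /D /= in_itv /= lee_fin => /andP[u1 u2].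
  rewrite subr_ge0 ler_norml; apply/andP; split; lra.
- by move=> n u _; rewrite lee_fin le_max lexx.
- move=> u _; apply/lee_subgt0Pr => e e0; apply: limn_einf_ge_near.
  have ea0 : (0 < e / a)%R by rewrite divr_gt0.
  have [N HN] := ltr_add_invr ea0; rewrite add0r in HN.
  exists N => // n /= Nn; rewrite -EFinB lee_fin /f_ le_max; apply/orP; right.
  have nN : (n.+1%:R^-1 <= N.+1%:R^-1 :> R)%R by rewrite lef_pV2 ?posrE// ler_nat.
  have an : (a - a_ n <= e / 2)%R.
    have := le_lt_trans nN HN; rewrite /a_; move: (n.+1%:R^-1)%R => i.
    by rewrite ltr_pdivlMr// => ?; lra.
  have := v_a n; have : (`|u - v_ n| <= `|u - v| + `|v - v_ n|)%R.
    by rewrite -[(u - v_ n)%R](subrKA v) ler_normD.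
  by rewrite (distrC v); lra.
move=> n; have /andP[an0 an] := a_01 n.
have := tent_integral_le (H _ (a_01 n)); apply: le_trans.
rewrite le_eqVlt; apply/orP; left; apply/eqP.
rewrite integral_mkcond [RHS]integral_mkcond; apply: eq_integral => u _.
rewrite !patchE -/(v_ n).
have Du : (u \in `](v_ n - a_ n)%R, (v_ n + a_ n)%R[%classic) = (`|u - v_ n| < a_ n)%R.
  rewrite (_ : (_ \in _) = (v_ n - a_ n < u < v_ n + a_ n)%R); last first.
    by apply/idP/idP => [/set_mem|h1]; [|apply/mem_set]; rewrite /= in_itv.
  by rewrite ltr_norml; apply/idP/idP => /andP[? ?]; apply/andP; split; lra.
rewrite Du /f_; case: ltP => un.
  rewrite ifT; last first.
    apply/mem_set; rewrite /D /= in_itv /=; move: un; rewrite ltr_norml => /andP[? ?].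
    have := v_a n; rewrite ler_norml => /andP[? ?].
    by apply/andP; split; lra.
  by rewrite (max_idPr _)// subr_ge0 ltW.
case: ifP => // _; rewrite (max_idPl _)// subr_le0//.
Qed.

End tents.

Section cuts.
Context (R : realType) (l r : \bar R) (m : {measure set R -> \bar R})
  (hbar : R) (a : R -> \bar R -> R) (I : set R) (h : R).
Hypotheses (Ha : scale_factors I l r hbar a) (Hsmall : hbar_small l r m hbar a)
  (hh : (0 < h < hbar)%R) (Is : I `<=` [set x | l <= x%:E <= r]).

Lemma left_inf_ge0 : 0 <= left_inf l r m h.
Proof. by apply: le_ereal_inf_tmp => _ [b [b0 _ _] <-]; rewrite lee_fin ltW. Qed.

Lemma right_inf_ge0 : 0 <= right_inf l r m h.
Proof. by apply: le_ereal_inf_tmp => _ [b [b0 _ _] <-]; rewrite lee_fin ltW. Qed.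

Lemma central_sub_interior : l < r -> central_set l r m a h `<=` interior_of l r.
Proof.
move=> lr v [|[]//]; rewrite /= /left_cut /right_cut => /andP[].
move: left_inf_ge0 right_inf_ge0; set L := left_inf _ _ _ _; set Q := right_inf _ _ _ _.
move=> L0 Q0 lv vr; apply/andP; split.
  case: ifPn lv => [/eqP->//|_ lv].
  by apply: le_lt_trans lv; rewrite leeDl.
case: ifPn vr => [/eqP->//|_ vr].
by apply: lt_le_trans vr _; rewrite geeDl// leeNl oppe0.
Qed.

Section noncentral.
Variable v : R.
Hypotheses (Iv : interior_of l r v) (cv : ~ central_set l r m a h v)
  (Idn : I (v - a h v%:E)%R) (Iup : I (v + a h v%:E)%R).
Let al := a h v%:E.

Let al0 : (0 < al)%R.
Proof.
have /andP[lv vr] := Iv.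
rewrite lt_neqAle (scale_ge0 Ha hh) ?(ltW lv) ?(ltW vr)// andbT.
apply/eqP => al0; apply: cv; right.
by rewrite /= -/al -al0 subr0 addr0.
Qed.

(** Otherwise v would be the midpoint of (l, r), where the radius is less than
    (r - l) / 2. *)
Lemma noncentral_not_both : ~ ((v - al)%:E = l /\ (v + al)%:E = r).
Proof.
move=> [El Er].
have [] := Hsmall _ _ hh; [by rewrite -El|by rewrite -Er|].
move=> _ _; rewrite -El -Er -EFinD -EFinM -EFinB -EFinM.
rewrite (_ : (_ / 2)%R = v); last by field.
by rewrite lte_fin -/al (_ : (_ / 2)%R = al) ?ltxx//; field.
Qed.

Lemma noncentral_one : (v - al)%:E = l \/ (v + al)%:E = r.
Proof.
have /andP[lv vr] := Iv.
have lu : (v - al)%:E < r by apply: lt_trans vr; rewrite lte_fin; have := al0; lra.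
have ul : l < (v + al)%:E by apply: lt_trans lv _; rewrite lte_fin; have := al0; lra.
have [Il|[->|rE]] := closure_caseP (Is Idn); last 2 first.
- by left.
- by move: lu; rewrite rE ltxx.
have [Ir|[lE|->]] := closure_caseP (Is Iup); last 2 first.
- by move: ul; rewrite lE ltxx.
- by right.
by exfalso; apply: cv; right.
Qed.

Lemma noncentral_boundary_up : is_boundary l r (v + al)%R <-> (v + al)%:E = r.
Proof.
split=> [[lE|//]|]; last by right.
have /andP[lv _] := Iv; move: lv; rewrite -lE lte_fin => ?; exfalso; have := al0; lra.
Qed.

Lemma noncentral_boundary_dn : is_boundary l r (v - al)%R <-> (v - al)%:E = l.
Proof.
split=> [[//|rE]|]; last by left.
have /andP[_ vr] := Iv; move: vr; rewrite -rE lte_fin => ?; exfalso; have := al0; lra.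
Qed.

Lemma left_inf_le_half : left_inf l r m h \is a fin_num ->
  left_inf l r m h <= (r - l) * (2^-1)%:E.
Proof.
move=> Lf; have : left_inf l r m h < +oo by rewrite ltey_eq Lf.
move=> /ereal_inf_ltP[_ [b [b0 bl hb] <-] _].
by apply: (le_trans _ bl); apply: ereal_inf_lbound; exists b.
Qed.

Lemma right_inf_le_half : right_inf l r m h \is a fin_num ->
  right_inf l r m h <= (r - l) * (2^-1)%:E.
Proof.
move=> Lf; have : right_inf l r m h < +oo by rewrite ltey_eq Lf.
move=> /ereal_inf_ltP[_ [b [b0 bl hb] <-] _].
by apply: (le_trans _ bl); apply: ereal_inf_lbound; exists b.
Qed.

(** A point outside I_h lies to the left of l_h or to the right of r_h. In the
    second case it lies to the right of the midpoint of (l, r), so that an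
    interval around it that reaches l would reach r as well. *)
Lemma noncentral_left_cut : (v - al)%:E = l -> v%:E <= left_cut l r m h.
Proof.
move=> El; have /andP[lv vr] := Iv.
have /andP[_ ur] := Is Iup; rewrite -/al in ur.
rewrite leNgt; apply/negP => lcv; apply: cv; left => /=; rewrite lcv /=.
rewrite /right_cut; case: ifPn => [_|/eqP rN]; first exact: ltry.
have [rho Er] : exists rho, r = rho%:E.
  by case: r rN vr => [rho| |]//; exists rho.
have lf : l \is a fin_num by rewrite -El.
have rf : r \is a fin_num by rewrite Er.
have [_ Rf _] := Hsmall lf rf hh.
have := right_inf_le_half Rf; rewrite -[right_inf _ _ _ _]fineK//.
set q := fine _; rewrite Er -El -EFinB -EFinM -EFinB lee_fin lte_fin => q1.
rewrite ltNge; apply/negP => q2.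
apply: noncentral_not_both; split => //.
rewrite Er in ur *; rewrite lee_fin in ur; congr EFin; apply/eqP.
by rewrite eq_le ur /=; lra.
Qed.

Lemma noncentral_right_cut : (v + al)%:E = r -> right_cut l r m h <= v%:E.
Proof.
move=> Er; have /andP[lv vr] := Iv.
have /andP[dl _] := Is Idn; rewrite -/al in dl.
rewrite leNgt; apply/negP => vrc; apply: cv; left => /=; rewrite vrc andbT.
rewrite /left_cut; case: ifPn => [_|/eqP lN]; first exact: ltNyr.
have [lam El] : exists lam, l = lam%:E.
  by case: l lN lv => [lam| |]//; exists lam.
have lf : l \is a fin_num by rewrite El.
have rf : r \is a fin_num by rewrite -Er.
have [Lf _ _] := Hsmall lf rf hh.
have := left_inf_le_half Lf; rewrite -[left_inf _ _ _ _]fineK//.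
set q := fine _; rewrite El -Er -EFinB -EFinM -EFinD lee_fin lte_fin => q1.
rewrite ltNge; apply/negP => q2.
apply: noncentral_not_both; split => //.
rewrite El in dl *; rewrite lee_fin in dl; congr EFin; apply/eqP.
by rewrite eq_le dl andbT; lra.
Qed.

Let al_le_half a' : (a' < al)%R -> a'%:E <= (r - l) * (2^-1)%:E.
Proof.
move=> a'a; have /andP[lv vr] := Iv.
have /andP[_ ur] := Is Iup; rewrite -/al in ur.
have /andP[dl _] := Is Idn; rewrite -/al in dl.
apply: (@le_trans _ _ (((v + al)%:E - (v - al)%:E) * (2^-1)%:E)).
  by rewrite -EFinB -EFinM lee_fin; lra.
by rewrite lee_pmul2r// leeB.
Qed.

(** The mean exit time c is at most h outside I_h: the radius of an interval
    that reaches l is at most the infimum that defines l_h. Hence the delay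
    2 (h - c) is nonnegative, which a stopping time requires. *)
Lemma noncentral_tent_le : half_tent_integral m v al <= h%:E.
Proof.
have ap := al0.
have [El|Er] := noncentral_one.
  apply: (@half_tent_le_limit _ _ _ _ 1%R) => //; first by rewrite normr1.
  move=> a' /andP[a'0 a'a]; rewrite leNgt; apply/negP => hlt.
  have lN : (l == -oo) = false by rewrite -El.
  have Linf : left_inf l r m h <= a'%:E.
    apply: ereal_inf_lbound; exists a' => //; split => //; first exact: al_le_half.
    have e : (v + 1 * (a' - al) = fine l + a')%R by rewrite -El /=; ring.
    by rewrite -e; exact: ltW.
  have := noncentral_left_cut El; rewrite /left_cut lN => /le_trans/(_ (leeD2l l Linf)).
  by rewrite -El -EFinD lee_fin; lra.
apply: (@half_tent_le_limit _ _ _ _ (-1)%R) => //; first by rewrite normrN normr1.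
move=> a' /andP[a'0 a'a]; rewrite leNgt; apply/negP => hlt.
have rN : (r == +oo) = false by rewrite -Er.
have Rinf : right_inf l r m h <= a'%:E.
  apply: ereal_inf_lbound; exists a' => //; split => //; first exact: al_le_half.
  have e : (v + -1 * (a' - al) = fine r - a')%R by rewrite -Er /=; ring.
  by rewrite -e; exact: ltW.
have := noncentral_right_cut Er; rewrite /right_cut rN => /(le_trans (leeB (lexx r) Rinf)).
by rewrite -Er -EFinB lee_fin; lra.
Qed.

End noncentral.
End cuts.

(** * The embedding times *)

Lemma measurable_bool_mem d (T : measurableType d) (A : set T) : measurable A ->
  measurable_fun [set: T] (fun x => x \in A).
Proof.
move=> mA; apply: (@measurable_fun_bool _ _ _ _ true); rewrite setTI.
by rewrite (_ : _ @^-1` _ = A)//; apply/seteqP; split => x /=; [move/set_mem|move/mem_set].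
Qed.

Section embedding_step.
Context d (R : realType) (Omega : measurableType d) (I : set R) (l r : \bar R)
  (F : R -> set (set Omega)) (P : R -> probability Omega R)
  (Y : R -> Omega -> R) (m : {measure set R -> \bar R})
  (hbar : R) (a : R -> \bar R -> R).
Hypotheses (HY : general_diffusion I l r F P Y m)
  (Ha : scale_factors I l r hbar a) (Hsmall : hbar_small l r m hbar a).
Variable h : R.
Hypothesis hh : (0 < h < hbar)%R.

Let markov := diffusion_markov HY.
Let filt := markov_filtration markov.
Let adapted := markov_adapted markov.
Let contY : forall w, continuous_path (Y ^~ w) := markov_continuous markov.
Let Is := diffusion_sub_closure HY.
Let mI : measurable I := state_space_measurable HY.

(** Only the restriction of a h to [l, r] is known to be measurable; this extension is a
    measurable function on the line. *)
Definition radius v : R := if v \in interior_of l r then a h v%:E else 0%R.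
Definition upper_end v := (v + radius v)%R.
Definition lower_end v := (v - radius v)%R.

Definition delay v x : R :=
  if v \in central_set l r m a h then 0%R
  else if v \in interior_of l r then
    (2 * (h - fine (mean_exit_time P Y a h v)) * \1_(is_boundary l r) x)%R
  else 0%R.

(** The functional rho with tau_{k+1} = tau_k + rho (Y after tau_k). *)
Definition increment : (R -> R) -> \bar R :=
  step (interior_of l r) upper_end lower_end
    (fun v => delay v (upper_end v)) (fun v => delay v (lower_end v)) h.
Definition rational_increment : (R -> R) -> \bar R :=
  rational_step (interior_of l r) upper_end lower_end
    (fun v => delay v (upper_end v)) (fun v => delay v (lower_end v)) h.

Lemma central_interior : central_set l r m a h `<=` interior_of l r.
Proof. exact: central_sub_interior (diffusion_lt HY). Qed.

Lemma measurable_radius : measurable_fun [set: R] radius.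
Proof.
apply: measurable_fun_if => //.
- by apply: measurable_bool_mem; exact: measurable_interior_of.
- rewrite setTI (_ : _ @^-1` _ = interior_of l r); last first.
    by apply/seteqP; split => x /=; [move/set_mem|move/mem_set].
  have mS : measurable [set x : \bar R | l <= x <= r].
    rewrite (_ : mkset _ = `[l, r]%classic); first exact: emeasurable_itv.
    by apply/seteqP; split => x /=; rewrite in_itv.
  apply: (measurable_comp mS) (scale_measurable Ha hh) _.
    by move=> _ [x /andP[lx xr] <-]; apply/andP; split; exact: ltW.
  exact/measurable_EFinP.
Qed.

Lemma measurable_upper_end : measurable_fun [set: R] upper_end.
Proof. by apply: measurable_funD => //; exact: measurable_radius. Qed.

Lemma measurable_lower_end : measurable_fun [set: R] lower_end.
Proof. by apply: measurable_funB => //; exact: measurable_radius. Qed.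

Lemma radiusE v : interior_of l r v -> radius v = a h v%:E.
Proof. by move=> Iv; rewrite /radius mem_set. Qed.

Lemma radius_ge0 v : (0 <= radius v)%R.
Proof.
rewrite /radius; case: ifPn => // /set_mem/andP[lv vr].
by rewrite (scale_ge0 Ha hh)// (ltW lv) (ltW vr).
Qed.

Lemma upper_end_state v : interior_of l r v -> I (upper_end v).
Proof. by move=> Iv; rewrite /upper_end radiusE//; case: (scale_state_space Ha hh Iv). Qed.

Lemma lower_end_state v : interior_of l r v -> I (lower_end v).
Proof. by move=> Iv; rewrite /lower_end radiusE//; case: (scale_state_space Ha hh Iv). Qed.

Lemma measurable_central : measurable (central_set l r m a h).
Proof.
apply: measurableU; first exact: (measurable_interior_of (left_cut l r m h) (right_cut l r m h)).
rewrite (_ : mkset _ = interior_of l r `&` (lower_end @^-1` interior_of l r `&` upper_end @^-1` interior_of l r)).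
  apply: measurableI; first exact: measurable_interior_of.
  apply: measurableI; rewrite -[X in measurable X]setTI.
    by apply: measurable_lower_end => //; exact: measurable_interior_of.
  by apply: measurable_upper_end => //; exact: measurable_interior_of.
apply/seteqP; split => v /=.
  by move=> [Iv ? ?]; split => //; rewrite /lower_end /upper_end radiusE.
by move=> [Iv []]; rewrite /lower_end /upper_end radiusE.
Qed.

Lemma mean_exit_timeE v : interior_of l r v ->
  mean_exit_time P Y a h v = \int[P v]_w hit_either (lower_end v) (upper_end v) (traj Y w).
Proof.
move=> Iv; apply: eq_integral => w _.
by rewrite /hitting_time2 !hitting_timeE /hit_either /lower_end /upper_end radiusE.
Qed.

(** The levels can be read off the path as functions of its starting point,
    so this is the mean of one fixed functional of the path under P v, and the
    measurability of the Markov kernel applies. *)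
Lemma measurable_mean_exit_time :
  measurable_fun (interior_of l r) (mean_exit_time P Y a h).
Proof.
pose G (p : paths R) := Order.min (rational_hit lower_end p) (rational_hit upper_end p).
have mG : measurable_fun [set: paths R] G.
  by apply: measurable_mine; apply: measurable_rational_hit; [exact: measurable_lower_end|exact: measurable_upper_end].
have rational_hit_ge0 b (p : R -> R) : 0 <= rational_hit b p.
  by apply: le_ereal_inf_tmp => _ [q [q0 _] <-]; rewrite lee_fin.
have G0 p : 0 <= G p by rewrite /G le_min !rational_hit_ge0.
have := measurable_funS mI (diffusion_sub_interior HY) (measurable_path_mean markov mG G0).
apply: eq_measurable_fun => v /set_mem Iv.
rewrite mean_exit_timeE//; apply: ge0_ae_eq_integral => //.
- exact: (measurableT_comp mG (measurable_traj markov)).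
- exact: (measurable_hit_either markov).
- by move=> w _; exact: hit_either_ge0.
- have := start_ae markov (diffusion_sub_interior HY Iv); apply: filterS => w Yv _.
  rewrite /G !rational_hitE; [|exact: (continuous_traj markov)|exact: (continuous_traj markov)].
  by rewrite /hit_either /hit /traj Yv.
Qed.

Lemma mean_exit_time_ge0 v : 0 <= mean_exit_time P Y a h v.
Proof.
apply: integral_ge0 => w _.
by rewrite /hitting_time2 !hitting_timeE le_min !hit_ge0.
Qed.

Section interior_point.
Variable v : R.
Hypothesis Iv : interior_of l r v.

Lemma mean_exit_time_tent : (0 < radius v)%R ->
  mean_exit_time P Y a h v = half_tent_integral m v (radius v).
Proof.
move=> r0; rewrite mean_exit_timeE// -(mean_exit_center HY r0) //.
  exact: lower_end_state.
exact: upper_end_state.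
Qed.

Lemma noncentral_radius_gt0 : ~ central_set l r m a h v -> (0 < radius v)%R.
Proof.
move=> cv; rewrite lt_neqAle radius_ge0 andbT; apply/eqP => r0; apply: cv; right.
by rewrite /= -radiusE// -r0 subr0 addr0.
Qed.

Lemma noncentral_mean_le : ~ central_set l r m a h v ->
  exists2 c, half_tent_integral m v (radius v) = c%:E & (0 <= c <= h)%R.
Proof.
move=> cv; have [Id Iu] := scale_state_space Ha hh Iv.
have := noncentral_tent_le Ha Hsmall hh Is Iv cv Id Iu.
rewrite -radiusE// => tl; have := mean_exit_time_ge0 v.
rewrite mean_exit_time_tent ?noncentral_radius_gt0//.
move: tl; case: (half_tent_integral _ _ _) => // c; rewrite !lee_fin => ? ?.
by exists c => //; apply/andP.
Qed.

End interior_point.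

Lemma delay_bounds v x : (0 <= delay v x <= 2 * h)%R.
Proof.
have h0 : (0 < h)%R by case/andP: hh.
have h2 : (0 <= 2 * h)%R by rewrite mulr_ge0// ltW.
rewrite /delay; case: ifPn => [_|/negP cv]; first by rewrite lexx.
case: ifPn => [/set_mem Iv|_]; last by rewrite lexx.
have ncv : ~ central_set l r m a h v by move=> c; apply: cv; exact/mem_set.
have [c cE /andP[c0 ch]] := noncentral_mean_le Iv ncv.
rewrite mean_exit_time_tent ?noncentral_radius_gt0// cE /= indicE.
case: (_ \in _); rewrite ?mulr1 ?mulr0 ?lexx//.
by apply/andP; split; lra.
Qed.

Lemma measurable_delay b : measurable_fun [set: R] b ->
  measurable_fun [set: R] (fun v => delay v (b v)).
Proof.
move=> mb; apply: measurable_fun_ifT => //.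
  by apply: measurable_bool_mem; exact: measurable_central.
apply: measurable_fun_if => //.
  by apply: measurable_bool_mem; exact: measurable_interior_of.
rewrite setTI (_ : _ @^-1` _ = interior_of l r); last first.
  by apply/seteqP; split => x /=; [move/set_mem|move/mem_set].
apply: measurable_funM; last first.
  have mB : measurable (is_boundary l r) by exact: (@measurable_boundary _ l r).
  by apply: measurable_funTS; apply: (measurableT_comp (measurable_indic mB) mb).
apply: measurable_funM => //; apply: measurable_funB => //.
by apply: measurableT_comp => //; exact: measurable_mean_exit_time.
Qed.

Lemma increment_ge0 p : 0 <= increment p.
Proof.
apply: step_ge0; first by case/andP: hh => /ltW.
  by move=> x; case/andP: (delay_bounds x (upper_end x)).
by move=> x; case/andP: (delay_bounds x (lower_end x)).
Qed.

Lemma rational_incrementE p : continuous_path p -> rational_increment p = increment p.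
Proof. exact: rational_stepE. Qed.

Lemma measurable_rational_increment : measurable_fun [set: paths R] (rational_increment : paths R -> \bar R).
Proof.
apply: measurable_rational_step.
- exact: measurable_interior_of.
- exact: measurable_upper_end.
- exact: measurable_lower_end.
- exact: measurable_delay measurable_upper_end.
- exact: measurable_delay measurable_lower_end.
Qed.

Lemma increment_stop p u : continuous_path p -> (0 <= u)%R ->
  (increment (fun t => p (Num.min t u)) <= u%:E) = (increment p <= u%:E).
Proof.
apply: step_stop.
  by move=> x; case/andP: (delay_bounds x (upper_end x)).
by move=> x; case/andP: (delay_bounds x (lower_end x)).
Qed.

Let tau := embedding_time l r P Y m a h.

Lemma exit_timeE w (s : R) : (0 <= s)%R -> let x := Y s w in
  interior_of l r x ->
  exit_time Y a h s%:E w =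
    s%:E + Order.min (hit upper_end (fun t => Y (s + t)%R w)) (hit lower_end (fun t => Y (s + t)%R w)).
Proof.
move=> s0 x Ix; rewrite /exit_time /= -/x.
have hitE b t : (0 <= t)%R -> Y (s + t)%R w = b x ->
    hit b (fun t => Y (s + t)%R w) <= t%:E.
  move=> t0 Yb; apply: ereal_inf_lbound; exists t => //; split => //.
  by rewrite addr0 -/x.
have r0 := radius_ge0 x.
apply/eqP; rewrite eq_le; apply/andP; split.
  have le1 b : (b = upper_end \/ b = lower_end) ->
      ereal_inf [set t%:E | t in [set t | s%:E <= t%:E /\ `|Y t w - x|%R = a h x%:E]] <=
      s%:E + hit b (fun t => Y (s + t)%R w).
    move=> bE; rewrite -leeBlDl//; apply: le_ereal_inf_tmp => _ [t [t0 pt] <-].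
    rewrite leeBlDl// -EFinD; apply: ereal_inf_lbound; exists (s + t)%R => //.
    split; first by rewrite lee_fin lerDl.
    rewrite pt addr0 -/x -radiusE//.
    by case: bE => ->; rewrite /upper_end /lower_end addrC addKr ?normrN ger0_norm.
  by have [hud|hdu] := leP (hit upper_end _) (hit lower_end _); apply: le1; [left|right].
apply: le_ereal_inf_tmp => _ [t [st pt] <-]; rewrite lee_fin in st.
have t0 : (0 <= t - s)%R by rewrite subr_ge0.
rewrite -leeBrDl// -EFinB ge_min; rewrite -radiusE// in pt.
have [xt|tx] := leP x (Y t w).
  apply/orP; left; apply: hitE => //.
  by rewrite [(s + _)%R]addrC subrK /upper_end -pt ger0_norm ?subr_ge0// [(x + _)%R]addrC subrK.
apply/orP; right; apply: hitE => //.
by rewrite [(s + _)%R]addrC subrK /lower_end -pt ltr0_norm ?subr_lt0// opprK [(x + _)%R]addrC subrK.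
Qed.

(** Also true when tau_k is infinite, as both sides then are. *)
Lemma embedding_timeS k w : 0 <= tau k w ->
  tau k.+1 w = tau k w + increment (after Y (tau k) w).
Proof.
move=> tk0; rewrite /tau /= -/(tau k w).
have h0 : (0 < h)%R by case/andP: hh.
case sE : (tau k w) tk0 => [s| |] // s0; last first.
  have -> : exit_time Y a h +oo w = +oo.
    rewrite /exit_time (_ : [set t | _] = set0) ?image_set0 ?ereal_inf0//.
    by apply/seteqP; split => t //= [].
  have -> : +oo + increment (after Y (tau k) w) = +oo.
    by rewrite addye// gt_eqF// (lt_le_trans _ (increment_ge0 _))// ltNyr.
  by case: ifP => _ //; case: ifP.
rewrite lee_fin in s0.
have aE : after Y (tau k) w = fun t => Y (s + t)%R w.
  by apply/funext => t; rewrite /after sE.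
rewrite aE /increment /step /step_with /= addr0.
set x := Y s w.
have [Ix|nIx] := boolP (x \in interior_of l r); last first.
  rewrite ifF//; apply/negP => /set_mem/central_interior/mem_set; exact/negP.
have Ix' := set_mem Ix.
rewrite (exit_timeE s0 Ix') -/x.
set p := (fun t => Y (s + t)%R w).
have cp : continuous_path p by apply: (@continuous_path_shift _ (Y ^~ w)).
have p0 : p 0%R = x by rewrite /p addr0.
have attained b (t : R) : hit b p = t%:E -> Y (s + t)%R w = b x.
  move=> hb; have t0 : (0 <= t)%R by rewrite -lee_fin -hb hit_ge0.
  have [u /andP[u0 ut] pu] : exists2 t', (0 <= t' <= t)%R & p t' = b (p 0%R).
    by apply/hit_le => //; rewrite hb.
  have : hit b p <= u%:E by apply: ereal_inf_lbound; exists u.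
  rewrite hb lee_fin => tu; have -> : t = u by apply/eqP; rewrite eq_le tu ut.
  by rewrite -p0 -pu.
rewrite /delay; have [cx|ncx] := boolP (x \in central_set l r m a h).
  by rewrite !adde0; case: ltP.
rewrite Ix.
have [hud|hdu] := ltP (hit upper_end p) (hit lower_end p).
  case uE : (hit upper_end p) => [t| |]; last 2 first.
  - by rewrite !addye.
  - by have := hit_ge0 upper_end p; rewrite uE.
  by rewrite addeA -EFinD /= (attained upper_end t uE).
case dE : (hit lower_end p) => [t| |]; last 2 first.
- by rewrite !addye.
- by have := hit_ge0 lower_end p; rewrite dE.
by rewrite addeA -EFinD /= (attained lower_end t dE).
Qed.

Lemma embedding_stopping k : stopping_time F (tau k).
Proof.
elim: k => [|k IH]; first exact: (stopping_time_cst filt (lexx 0%R)).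
have := stopping_time_add filt adapted contY IH increment_ge0
  measurable_rational_increment rational_incrementE increment_stop.
congr (stopping_time _ _); apply/funext => w.
by rewrite -embedding_timeS//; exact: IH.1.
Qed.

Section one_step_bounds.
Variable eps : R.
Hypotheses (eps0 : (0 < eps)%R) (eps1 : (eps <= 1 / 2)%R)
  (Herr : scale_error l r m a h <= (eps * h)%:E).

Let h0 : (0 < h)%R. Proof. by case/andP: hh. Qed.

(** The radius cannot be 0 in I_h: the tent would vanish and the error would
    be h. *)
Lemma central_tent v : central_set l r m a h v ->
  (0 < radius v)%R /\
  exists2 c, half_tent_integral m v (radius v) = c%:E & (`|c - h| <= eps * h)%R.
Proof.
move=> cv; have Iv := central_interior cv.
have He : `|half_tent_integral m v (radius v) - h%:E| <= (eps * h)%:E.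
  apply: le_trans Herr; rewrite /scale_error le_max; apply/orP; right.
  by apply: ereal_sup_ubound; exists v => //; rewrite radiusE.
have eh : (eps * h < h)%R by have := h0; have := eps1; nra.
split.
  rewrite lt_neqAle radius_ge0 andbT; apply/eqP => r0; move: He.
  rewrite /half_tent_integral -r0 subr0 addr0 set_itv_ge ?bnd_simp ?ltxx//.
  rewrite integral_set0 mule0 add0e abseN /= lee_fin ger0_norm; last exact: ltW.
  by rewrite leNgt eh.
move: He; case: (half_tent_integral _ _ _) => [c| |] //=.
by rewrite lee_fin => He; exists c.
Qed.

(** The mean of a step is c plus the average of the two delays, which is c in
    I_h and c + (h - c) outside. *)
Lemma interior_tent v : interior_of l r v ->
  (0 < radius v)%R /\
  exists c, [/\ half_tent_integral m v (radius v) = c%:E, (c <= 2 * h)%R &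
    (`|c + (delay v (upper_end v) + delay v (lower_end v)) / 2 - h| <= eps * h)%R].
Proof.
move=> Iv; have [cv|ncv] := pselect (central_set l r m a h v).
  have [r0 [c cE ch]] := central_tent cv; split=> //; exists c.
  rewrite /delay mem_set// addr0 mul0r addr0; split => //.
  have := ler_norm (c - h)%R; have := h0; have := eps1; nra.
have r0 := noncentral_radius_gt0 Iv ncv; split => //.
have [c cE /andP[c0 ch]] := noncentral_mean_le Iv ncv.
exists c; split => //; first by have := h0; lra.
have [Id Iu] := scale_state_space Ha hh Iv.
rewrite /delay memNset// mem_set// mean_exit_time_tent// cE /= !indicE.
have upE : (upper_end v \in is_boundary l r) = ((v + a h v%:E)%:E == r).
  rewrite /upper_end radiusE//; apply/idP/eqP.
    by move/set_mem/(noncentral_boundary_up Ha hh Iv ncv).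
  by move=> ?; apply/mem_set/(noncentral_boundary_up Ha hh Iv ncv).
have dnE : (lower_end v \in is_boundary l r) = ((v - a h v%:E)%:E == l).
  rewrite /lower_end radiusE//; apply/idP/eqP.
    by move/set_mem/(noncentral_boundary_dn Ha hh Iv ncv).
  by move=> ?; apply/mem_set/(noncentral_boundary_dn Ha hh Iv ncv).
rewrite upE dnE.
have := noncentral_one Ha hh Is Iv ncv Id Iu.
have := @noncentral_not_both _ _ _ _ _ _ _ Hsmall hh v.
case: eqP => Eu; case: eqP => El; rewrite ?mulr1 ?mulr0.
- by move=> /(_ (conj El Eu)).
- move=> _ _; rewrite (_ : (_ - h)%R = 0%R) ?normr0 ?mulr_ge0 ?ltW//; by field.
- move=> _ _; rewrite (_ : (_ - h)%R = 0%R) ?normr0 ?mulr_ge0 ?ltW//; by field.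
- by move=> _ [].
Qed.

(** The form of a step to which the estimates for one exit apply. *)
Lemma rational_increment_interior_ae v : interior_of l r v ->
  {ae P v, forall w, rational_increment (traj Y w) = 
    (fine (hit_either (lower_end v) (upper_end v) (traj Y w)) + delay v (lower_end v) +
     (delay v (upper_end v) - delay v (lower_end v)) *
       \1_([set w | (hit (fun=> upper_end v) (traj Y w) < hit (fun=> lower_end v) (traj Y w))%E]) w)%:E}.
Proof.
move=> Iv; have [r0 [c [cE _ _]]] := interior_tent Iv.
have := exit_finite_ae HY r0 (lower_end_state Iv) (upper_end_state Iv) cE.
have := start_ae markov (diffusion_sub_interior HY Iv).
apply: filterS2 => w Yv fH.
rewrite rational_incrementE; last exact: (continuous_traj markov).
have p0 : traj Y w 0%R = v by exact: Yv.
have hE b : hit b (traj Y w) = hit (fun=> b v) (traj Y w) by rewrite /hit p0.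
rewrite /increment /step /step_with (hE upper_end) (hE lower_end) p0 mem_set//.
move: fH; rewrite /hit_either minC -/(lower_end v) -/(upper_end v).
have [hud|hdu] := ltP (hit (fun=> upper_end v) (traj Y w)) (hit (fun=> lower_end v) (traj Y w)) => fH.
  rewrite indicE mem_set// mulr1 -[X in X + _]fineK// -EFinD; congr EFin; ring.
rewrite indicE memNset /= ?mulr0 ?addr0; last by rewrite ltNge hdu.
by rewrite -[X in X + _]fineK// -EFinD.
Qed.

Lemma rational_increment_finite v : I v -> {ae P v, forall w, rational_increment (traj Y w) \is a fin_num}.
Proof.
move=> Iv; have [Ii|nI] := pselect (interior_of l r v).
  by have := rational_increment_interior_ae Ii; apply: filterS => w ->.
have := start_ae markov Iv; apply: filterS => w Yv.
by rewrite /rational_increment /rational_step /step_with /traj Yv memNset.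
Qed.

Lemma one_step_exp v theta : I v -> (`|theta| <= exit_rate R / h / 2)%R ->
  path_mean P Y v (fun p => (expR (theta * (fine (rational_increment p) - h)))%:E) <=
  (1 + `|theta| * (eps * h) + 16 / (exit_rate R / h) ^+ 2 * theta ^+ 2 * (6 * expR (exit_rate R)))%:E.
Proof.
move=> Iv th; have [Ii|nI] := pselect (interior_of l r v); last first.
  rewrite /path_mean (ae_eq_integral (fun=> 1)) //.
  - have := integral_cst (P v) measurableT 1; rewrite /= probability_setT mule1 => ->.
    have eh : (0 <= eps * h)%R by rewrite mulr_ge0// ltW.
    have k0 : (0 <= 16 / (exit_rate R / h) ^+ 2 * theta ^+ 2)%R.
      by rewrite mulr_ge0 ?divr_ge0 ?sqr_ge0.
    by rewrite lee_fin -addrA lerDl addr_ge0// mulr_ge0// mulr_ge0// expR_ge0.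
  - apply/measurable_EFinP; apply: (measurableT_comp (@measurable_expR R)).
    apply: measurable_funM => //; apply: measurable_funB => //.
    by apply: measurableT_comp => //; exact: (measurableT_comp measurable_rational_increment (measurable_traj markov)).
  - have := start_ae markov Iv; apply: filterS => w Yv _.
    by rewrite /rational_increment /rational_step /step_with /traj Yv memNset//= subrr mulr0 expR0.
have [r0 [c [cE c2 cm]]] := interior_tent Ii.
have := step_exp_le HY r0 (lower_end_state Ii) (upper_end_state Ii) h0 cE c2 (delay_bounds v (upper_end v))
  (delay_bounds v (lower_end v)) cm th.
apply: le_trans; rewrite le_eqVlt; apply/orP; left; apply/eqP.
apply: ae_eq_integral => //.
- apply/measurable_EFinP; apply: (measurableT_comp (@measurable_expR R)).
  apply: measurable_funM => //; apply: measurable_funB => //.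
  by apply: measurableT_comp => //; exact: (measurableT_comp measurable_rational_increment (measurable_traj markov)).
- apply/measurable_EFinP; apply: (measurableT_comp (@measurable_expR R)).
  apply: measurable_funM => //; apply: measurable_funD.
    apply: measurable_funD => //; apply: measurableT_comp => //.
    exact: (measurable_hit_either markov).
  apply: measurable_funM => //; apply: measurable_indic.
  exact: (measurable_up_first HY).
have := rational_increment_interior_ae Ii; apply: filterS => w -> _ /=.
by congr (expR (theta * _))%:E; rewrite /upper_end /lower_end; ring.
Qed.

End one_step_bounds.

End embedding_step.

(** * Iteration over the embedding times *)

(** Take logarithms and use ln z <= z - 1 at z = x / (2 alpha). *)
Lemma powR_le_expR_half (R : realType) (alpha x : R) : (0 < alpha)%R -> (0 <= x)%R ->
  (x `^ alpha <= expR (alpha * (ln (2 * alpha) - 1)) * expR (x / 2))%R.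
Proof.
move=> al0; rewrite le_eqVlt => /predU1P[<-|x0].
  by rewrite powR0 ?lt0r_neq0// mulr_ge0 ?expR_ge0.
rewrite /powR gt_eqF// -expRD ler_expR.
have y0 : (0 < x / (2 * alpha))%R by rewrite divr_gt0// mulr_gt0.
have a20 : (0 < 2 * alpha)%R by rewrite mulr_gt0.
have -> : ln x = (ln (x / (2 * alpha)) + ln (2 * alpha))%R.
  by rewrite -lnM ?posrE// divfK// lt0r_neq0.
have l1 : (ln (x / (2 * alpha)) <= x / (2 * alpha) - 1)%R.
  have := @le_ln1Dx R (x / (2 * alpha) - 1)%R; rewrite addrCA subrr addr0; apply.
  by rewrite ltrBrDl subrr.
have := ler_wpM2l (ltW al0) l1.
have -> : (alpha * (x / (2 * alpha) - 1) = x / 2 - alpha)%R.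
  by field; exact: lt0r_neq0.
lra.
Qed.

(** Below dlt the power is at most that of dlt. Above dlt it is at most a
    constant times exp (theta |x| / 2), and one further factor
    exp (theta (|x| - dlt) / 2) >= 1 produces the small constant. *)
Lemma powR_le_cut_exp (R : realType) (alpha dlt theta x : R) :
  (0 < alpha)%R -> (0 <= dlt)%R -> (1 <= theta)%R ->
  (`|x| `^ alpha <= dlt `^ alpha + expR (alpha * (ln (2 * alpha) - 1)) *
     expR (- (theta * dlt / 2)) * (expR (theta * x) + expR (- theta * x)))%R.
Proof.
move=> al0 d0 th1; set C := expR (alpha * _).
have C0 : (0 <= C)%R by exact: expR_ge0.
have [xd|dx] := leP `|x|%R dlt.
  apply: (@le_trans _ _ (dlt `^ alpha)%R).
    by apply: ge0_ler_powR => //; rewrite ?nnegrE// ltW.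
  by rewrite lerDl !mulr_ge0 ?addr_ge0 ?expR_ge0.
apply: (@le_trans _ _ (C * expR (- (theta * dlt / 2)) * (expR (theta * x) + expR (- theta * x)))%R); last first.
  by rewrite lerDr powR_ge0.
apply: le_trans (powR_le_expR_half al0 (normr_ge0 x)) _.
rewrite -/C -mulrA; apply: ler_wpM2l => //.
apply: (@le_trans _ _ (expR (- (theta * dlt / 2)) * expR (theta * `|x|))%R).
  by rewrite -expRD ler_expR; have := normr_ge0 x; nra.
apply: ler_wpM2l; first exact: expR_ge0.
have [x0|x0] := leP 0%R x; first by rewrite ger0_norm// lerDl expR_ge0.
by rewrite ltr0_norm// mulrN -mulNr lerDr expR_ge0.
Qed.

Section iteration.
Context d (R : realType) (Omega : measurableType d) (I : set R) (l r : \bar R)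
  (F : R -> set (set Omega)) (P : R -> probability Omega R)
  (Y : R -> Omega -> R) (m : {measure set R -> \bar R})
  (hbar : R) (a : R -> \bar R -> R).
Hypotheses (HY : general_diffusion I l r F P Y m)
  (Ha : scale_factors I l r hbar a) (Hsmall : hbar_small l r m hbar a).
Variables (h eps y : R).
Hypotheses (hh : (0 < h < hbar)%R) (eps0 : (0 < eps)%R) (eps1 : (eps <= 1 / 2)%R)
  (Herr : scale_error l r m a h <= (eps * h)%:E) (Iy : I y).

Let markov := diffusion_markov HY.
Let filt := markov_filtration markov.
Let mI : measurable I := state_space_measurable HY.
Let tau := embedding_time l r P Y m a h.
Let mr : (R -> R) -> \bar R := rational_increment l r P Y m a h.

Let tau_st k : stopping_time F (tau k) := embedding_stopping HY Ha Hsmall hh k.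

Let mmr : measurable_fun [set: paths R] (mr : paths R -> \bar R) :=
  measurable_rational_increment HY Ha hh.

Let fin_tau k := [set w | tau k w < +oo].

Let m_tau k : measurable_fun [set: Omega] (tau k) :=
  stopping_time_measurable filt (tau_st k).

Let m_fin_tau k : measurable (fin_tau k).
Proof. by rewrite -[X in measurable X]setTI; exact: emeasurable_fun_infty_o. Qed.

Let tauS k w : tau k.+1 w = tau k w + mr (after Y (tau k) w).
Proof.
rewrite /mr rational_incrementE; last exact: (continuous_after (markov_continuous markov) (tau_st k)).
by apply: (embedding_timeS HY Ha Hsmall hh); exact: (tau_st k).1.
Qed.

Let mr_ge0 k w : 0 <= mr (after Y (tau k) w).
Proof.
rewrite /mr rational_incrementE; first exact: (increment_ge0 HY Ha Hsmall hh).
exact: (continuous_after (markov_continuous markov) (tau_st k)).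
Qed.

(** Almost surely no step is infinite, whatever its starting point. *)
Lemma embedding_time_finite k : P y (~` fin_tau k) = 0.
Proof.
elim: k => [|k IH].
  by rewrite (_ : ~` _ = set0) ?measure0//; apply/seteqP; split => w //=; apply; exact: ltry.
pose g (p : paths R) : R := \1_[set p : paths R | mr p = +oo] p.
have mB : measurable [set p : paths R | mr p = +oo].
  rewrite -[X in measurable X]setTI.
  by have := mmr measurableT (emeasurable_set1 +oo); congr (measurable (_ `&` _)).
have mg : measurable_fun [set: paths R] g by exact: measurable_indic.
have g0 p : (0 <= g p)%R by rewrite /g indicE.
have gmean v : I v -> path_mean P Y v (EFin \o g) <= 0%:E.
  move=> Iv; rewrite /path_mean (ae_eq_integral (cst 0)) ?integral0//.
    apply/measurable_EFinP; exact: (measurableT_comp mg (measurable_traj markov)).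
  have := rational_increment_finite HY Ha Hsmall hh eps0 eps1 Herr Iv; apply: filterS => w fr _ /=.
  by rewrite /g indicE memNset//= => mroo; move: fr; rewrite -/mr mroo.
have mone : measurable_fun [set: R] (fun=> 1%R : R) by exact: measurable_cst.
have one0 (x : R) : (0 <= 1 :> R)%R by exact: ler01.
have := strong_markov_weighted_le mI markov Iy (tau_st k) mone one0 mg g0 (lexx 0%R) gmean.
rewrite mul0e -/(fin_tau k) => H0.
have mX : measurable_fun [set: Omega] (after Y (tau k) : Omega -> paths R).
  exact: (measurable_after filt (markov_adapted markov) (markov_continuous markov) (tau_st k)).
pose B := [set w | mr (after Y (tau k) w) = +oo].
have mBX : measurable B.
  by have := mX measurableT _ mB; rewrite setTI.
have PB : P y (fin_tau k `&` B) = 0.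
  apply/eqP; rewrite eq_le measure_ge0 andbT; apply: le_trans H0.
  rewrite setIC -(integral_indic (P y) (m_fin_tau k) mBX).
  rewrite le_eqVlt; apply/orP; left; apply/eqP; apply: eq_integral => w _.
  by rewrite mul1e /g !indicE.
apply/eqP; rewrite eq_le measure_ge0 andbT.
apply: (@le_trans _ _ (P y (~` fin_tau k `|` (fin_tau k `&` B)))).
  apply: le_measure; rewrite ?inE.
  - exact/measurableC/m_fin_tau.
  - apply: measurableU; first exact/measurableC/m_fin_tau.
    by apply: measurableI => //; exact: m_fin_tau.
  move=> w /= /negP; rewrite tauS -leNgt leye_eq => toow.
  have [tf|] := pselect (fin_tau k w); last by left.
  right; split => //; rewrite /B /=.
  have := (tau_st k).1 w; move: toow tf; rewrite /fin_tau /=.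
  by case: (tau k w) => [t| |]//; case: (mr _).
apply: (@le_trans _ _ (P y (~` fin_tau k) + P y (fin_tau k `&` B))); last by rewrite IH PB adde0.
apply: measureU2; first exact/measurableC/m_fin_tau.
by apply: measurableI => //; exact: m_fin_tau.
Qed.

Lemma embedding_time_finite_ae n :
  {ae P y, forall w, forall k, (k <= n)%N -> tau k w \is a fin_num}.
Proof.
elim: n => [|n IH].
  by apply: aeW => w k; rewrite leqn0 => /eqP ->.
have H : {ae P y, forall w, tau n.+1 w \is a fin_num}.
  exists (~` fin_tau n.+1); split; [exact/measurableC/m_fin_tau|exact: embedding_time_finite|].
  move=> w /= nf; rewrite /fin_tau /= => tf; apply: nf.
  by rewrite ge0_fin_numE//; exact: (tau_st n.+1).1.
apply: filterS2 IH H => w Hn Hs k; rewrite leq_eqVlt => /predU1P[->//|].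
exact: Hn.
Qed.

Let dev k w : R := (fine (tau k w) - k%:R * h)%R.

Lemma measurable_exp_deviation theta k :
  measurable_fun [set: Omega] (fun w => (expR (theta * dev k w))%:E).
Proof.
apply/measurable_EFinP; apply: (measurableT_comp (@measurable_expR R)).
apply: measurable_funM => //; apply: measurable_funB => //.
exact: measurableT_comp.
Qed.

(** Induction on k: exp (theta D_k) is the weight in
    strong_markov_weighted_le. *)
Lemma exp_deviation_le theta k : (`|theta| <= exit_rate R / h / 2)%R ->
  \int[P y]_(w in fin_tau k) (expR (theta * dev k w))%:E <=
  ((1 + `|theta| * (eps * h) + 16 / (exit_rate R / h) ^+ 2 * theta ^+ 2 * (6 * expR (exit_rate R))) ^+ k)%:E.
Proof.
move=> th; set K := (1 + _ + _)%R.
have h0 : (0 < h)%R by case/andP: hh.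
have K0 : (0 <= K)%R.
  have eh : (0 <= eps * h)%R by rewrite mulr_ge0// ltW.
  have k0 : (0 <= 16 / (exit_rate R / h) ^+ 2 * theta ^+ 2)%R.
    by rewrite mulr_ge0 ?divr_ge0 ?sqr_ge0.
  apply: addr_ge0; first by apply: addr_ge0 => //; exact: mulr_ge0.
  by apply: mulr_ge0 => //; rewrite mulr_ge0// expR_ge0.
elim: k => [|k IH].
  rewrite expr0; under eq_integral => w _ do rewrite /dev /= mul0r subr0 mulr0 expR0.
  rewrite (_ : fin_tau 0 = setT); last by apply/seteqP; split => w //= _; exact: ltry.
  by have := integral_cst (P y) measurableT 1; rewrite /= probability_setT mule1 => ->.
pose g (p : paths R) : R := expR (theta * (fine (mr p) - h)).
have mg : measurable_fun [set: paths R] g.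
  apply: (measurableT_comp (@measurable_expR R)).
  apply: measurable_funM => //; apply: measurable_funB => //.
  by apply: measurableT_comp => //; exact: mmr.
have g0 p : (0 <= g p)%R by exact: expR_ge0.
have gK v (Iv : I v) : path_mean P Y v (EFin \o g) <= K%:E.
  exact: (one_step_exp HY Ha Hsmall hh eps0 eps1 Herr Iv th).
pose phi (t : R) : R := expR (theta * (t - k%:R * h)).
have mphi : measurable_fun [set: R] phi.
  apply: (measurableT_comp (@measurable_expR R)).
  by apply: measurable_funM => //; exact: measurable_funB.
have phi0 t : (0 <= phi t)%R by exact: expR_ge0.
have sub : fin_tau k.+1 `<=` fin_tau k.
  move=> w; rewrite /fin_tau /= tauS; apply: le_lt_trans.
  by rewrite leeDl// mr_ge0.
have mX : measurable_fun [set: Omega] (after Y (tau k) : Omega -> paths R).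
  exact: (measurable_after filt (markov_adapted markov) (markov_continuous markov) (tau_st k)).
have mprod : measurable_fun (fin_tau k) (fun w => (phi (fine (tau k w)))%:E * (g (after Y (tau k) w))%:E).
  apply: emeasurable_funM; apply: measurable_funTS.
    by apply/measurable_EFinP; apply: (measurableT_comp mphi); exact: measurableT_comp.
  by apply/measurable_EFinP; exact: (measurableT_comp mg mX).
have := strong_markov_weighted_le mI markov Iy (tau_st k) mphi phi0 mg g0 K0 gK.
rewrite -/(fin_tau k) => SM.
rewrite exprS EFinM.
apply: (@le_trans _ _ (K%:E * \int[P y]_(w in fin_tau k) (expR (theta * dev k w))%:E)); last first.
  by apply: lee_wpmul2l => //; rewrite lee_fin.
apply: (le_trans _ SM).
apply: (@le_trans _ _ (\int[P y]_(w in fin_tau k.+1)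
  ((phi (fine (tau k w)))%:E * (g (after Y (tau k) w))%:E))).
  rewrite le_eqVlt; apply/orP; left; apply/eqP; apply: eq_integral => w /set_mem fw.
  rewrite -EFinM -expRD -mulrDr; congr (expR (theta * _))%:E.
  have := sub _ fw; move: fw; rewrite /fin_tau /= /dev tauS.
  have := mr_ge0 k w; have := (tau_st k).1 w.
  case: (tau k w) => [t| |]//; case: (mr _) => [s| |]// _ _ _ _ /=.
  by rewrite -natr1; ring.
apply: ge0_subset_integral => //.
by move=> w _; rewrite mule_ge0 ?lee_fin.
Qed.

Lemma measurable_max_time_error T :
  measurable_fun [set: Omega] (max_time_error l r P Y m a T h).
Proof.
rewrite /max_time_error.
elim: (index_iota _ _) => [|k s IH].
  by under eq_fun do rewrite big_nil; exact: measurable_cst.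
under eq_fun do rewrite big_cons.
apply: measurable_maxe => //; apply: measurableT_comp => //.
by apply: emeasurable_funB => //; exact: m_tau.
Qed.

(** The maximum is one of the |D_k|; its power is bounded by the sum over k of
    the exponentials exp (theta D_k) + exp (- theta D_k). *)
Lemma max_error_moment_le (T alpha dlt theta : R) :
  (0 < alpha)%R -> (0 <= dlt)%R -> (1 <= theta)%R -> (theta <= exit_rate R / h / 2)%R ->
  forall N, N = Num.truncn (T / h) ->
  \int[P y]_w (`|max_time_error l r P Y m a T h w| `^ alpha) <=
  (dlt `^ alpha + N%:R * (expR (alpha * (ln (2 * alpha) - 1)) * expR (- (theta * dlt / 2)) *
     (2 * (1 + theta * (eps * h) + 16 / (exit_rate R / h) ^+ 2 * theta ^+ 2 * (6 * expR (exit_rate R))) ^+ N)))%:E.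
Proof.
move=> al0 d0 th1 thk N NE; set K := (1 + _ + _)%R; set c := (expR _ * expR _)%R.
have c0 : (0 <= c)%R by rewrite mulr_ge0 ?expR_ge0.
have th0 : (0 <= theta)%R by exact: le_trans th1.
have h0 : (0 < h)%R by case/andP: hh.
have K1 : (1 <= K)%R.
  have eh : (0 <= eps * h)%R by rewrite mulr_ge0// ltW.
  have k0 : (0 <= 16 / (exit_rate R / h) ^+ 2 * theta ^+ 2)%R.
    by rewrite mulr_ge0 ?divr_ge0 ?sqr_ge0.
  rewrite /K -addrA lerDl; apply: addr_ge0; first exact: mulr_ge0.
  by apply: mulr_ge0 => //; rewrite mulr_ge0// expR_ge0.
(* restricted to finite embedding times, since fine would give a meaningless
   deviation to an infinite one *)
pose Ep k := (fun w => (expR (theta * dev k w))%:E) \_ (fin_tau k).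
pose Em k := (fun w => (expR (- theta * dev k w))%:E) \_ (fin_tau k).
have Ep0 k w : 0 <= Ep k w by rewrite /Ep patchE; case: ifP => // _; rewrite lee_fin expR_ge0.
have Em0 k w : 0 <= Em k w by rewrite /Em patchE; case: ifP => // _; rewrite lee_fin expR_ge0.
have mEp k : measurable_fun [set: Omega] (Ep k).
  by apply/(measurable_restrictT _ (m_fin_tau k)); apply: measurable_funTS; exact: measurable_exp_deviation.
have mEm k : measurable_fun [set: Omega] (Em k).
  by apply/(measurable_restrictT _ (m_fin_tau k)); apply: measurable_funTS; exact: measurable_exp_deviation.
pose t k w := c%:E * (Ep k w + Em k w).
have t0 k w : 0 <= t k w by rewrite mule_ge0// ?lee_fin// adde_ge0.
have mt k : measurable_fun [set: Omega] (t k).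
  by apply: emeasurable_funM => //; exact: emeasurable_funD.
have it k : (k <= N)%N -> \int[P y]_w t k w <= (c * (2 * K ^+ N))%:E.
  move=> kN; rewrite ge0_integralZl_EFin//; last 2 first.
  - by move=> w _; rewrite adde_ge0.
  - exact: emeasurable_funD.
  rewrite [leRHS](EFinM c); apply: lee_wpmul2l; first by rewrite lee_fin.
  rewrite ge0_integralD// /Ep /Em -!integral_mkcond.
  have KN : (K ^+ k <= K ^+ N)%R by rewrite ler_weXn2l.
  have thk' : (`|theta| <= exit_rate R / h / 2)%R by rewrite ger0_norm.
  have thk'' : (`|- theta| <= exit_rate R / h / 2)%R by rewrite normrN.
  have := leeD (exp_deviation_le k thk') (exp_deviation_le k thk'').
  rewrite normrN sqrrN ger0_norm// -/K => /le_trans; apply.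
  by rewrite -EFinD lee_fin; lra.
apply: (@le_trans _ _ (\int[P y]_w ((dlt `^ alpha)%:E + \sum_(1 <= k < N.+1) t k w))).
  apply: ae_ge0_le_integral => //.
  - by move=> w _; exact: poweR_ge0.
  - apply: (measurableT_comp (measurable_poweR alpha)); apply: measurableT_comp => //.
    exact: measurable_max_time_error.
  - by move=> w _; rewrite adde_ge0 ?lee_fin ?powR_ge0// sume_ge0.
  - by apply: emeasurable_funD => //; exact: emeasurable_sum.
  have := embedding_time_finite_ae N; apply: filterS => w fw _.
  have RHS0 : 0 <= \sum_(1 <= k < N.+1) t k w by rewrite sume_ge0.
  have key k : (1 <= k < N.+1)%N ->
      `|tau k w - (k%:R * h)%:E| `^ alpha <= (dlt `^ alpha)%:E + \sum_(1 <= k < N.+1) t k w.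
    move=> kN; have /andP[k1 kN'] := kN.
    have fk := fw k kN'.
    have wk : fin_tau k w by rewrite /fin_tau /= ltey_eq fk.
    apply: (@le_trans _ _ ((dlt `^ alpha)%:E + t k w)).
      rewrite -(fineK fk) -EFinB /= -/(dev k w).
      rewrite /t /Ep /Em !patchE !mem_set// -(EFinD (expR _)) -(EFinM c) -EFinD lee_fin.
      exact: powR_le_cut_exp.
    rewrite leeD2l// (bigD1_seq k) ?mem_index_iota ?iota_uniq//= leeDl//.
    by rewrite sume_ge0.
  have /andP[] : (0 <= max_time_error l r P Y m a T h w) &&
    (max_time_error l r P Y m a T h w `^ alpha <= (dlt `^ alpha)%:E + \sum_(1 <= k < N.+1) t k w).
    rewrite /max_time_error -NE big_nat_cond.
    apply: (big_ind (fun x : \bar R => (0 <= x) &&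
      (x `^ alpha <= (dlt `^ alpha)%:E + \sum_(1 <= k < N.+1) t k w))).
    - rewrite lexx /= powR0 ?lt0r_neq0//.
      by rewrite adde_ge0// lee_fin powR_ge0.
    - by move=> x x1 Hx Hx1; rewrite /Order.max; case: ifP.
    - by move=> k; rewrite andbT => kN; rewrite abse_ge0 key.
  by move=> M0; rewrite gee0_abs.
rewrite ge0_integralD//; last 3 first.
- by move=> w _; rewrite lee_fin powR_ge0.
- by move=> w _; rewrite sume_ge0.
- exact: emeasurable_sum.
have := integral_cst (P y) measurableT (dlt `^ alpha)%:E; rewrite /= probability_setT mule1 => ->.
rewrite ge0_integral_sum// EFinD leeD2l//.
apply: (@le_trans _ _ (\sum_(1 <= k < N.+1) (c * (2 * K ^+ N))%:E)).
  rewrite big_nat_cond [leRHS]big_nat_cond; apply: lee_sum => k; rewrite andbT => /andP[_ kN].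
  exact: it.
by rewrite sumEFin sumr_const_nat subn1 /= [(N%:R * _)%R]mulr_natl.
Qed.

End iteration.

(** * Convergence *)

Lemma expRN_le_cube (R : realType) (x : R) : (0 < x)%R -> (expR (- x) <= 27 / x ^+ 3)%R.
Proof.
move=> x0; have x30 : (0 < x ^+ 3)%R by rewrite exprn_gt0.
rewrite expRN -[leLHS]div1r ler_pdivrMr ?expR_gt0// mulrAC ler_pdivlMr// mul1r.
have -> : x = (x / 3 + x / 3 + x / 3)%R by field.
rewrite !expRD; set e := expR (x / 3).
have e1 : (x / 3 <= e)%R by apply: le_trans (expR_ge1Dx _); rewrite lerDr.
have x3 : (0 <= x / 3)%R by rewrite divr_ge0// ltW.
have -> : ((x / 3 + x / 3 + x / 3) ^+ 3 = 27 * ((x / 3) * (x / 3) * (x / 3)))%R by field.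
by apply: ler_wpM2l => //; rewrite !ler_pM// mulr_ge0.
Qed.

(** With u = h^{1/2} and theta = 1 / u, the N-th power is at most
    exp (dlt / (4 u)) times a constant. Together with exp (- dlt / (2 u)) this
    leaves exp (- dlt / (4 u)), which is of order u^3 and absorbs
    N <= T / u^2. *)
Lemma deviation_bound_small (R : realType) (T h dlt eps C k B theta : R) (N : nat) :
  (0 < T)%R -> (0 < h)%R -> (0 < dlt)%R -> (0 <= eps)%R -> (eps <= dlt / (4 * T))%R ->
  (0 <= C)%R -> (0 < k)%R -> (0 <= B)%R -> (N%:R <= T / h)%R ->
  theta = (Num.sqrt h)^-1%R ->
  (N%:R * (C * expR (- (theta * dlt / 2)) *
     (2 * (1 + theta * (eps * h) + 16 / (k / h) ^+ 2 * theta ^+ 2 * B) ^+ N))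
  <= 2 * C * T * expR (T * (16 / k ^+ 2 * B)) * ((12 / dlt) ^+ 3) * Num.sqrt h)%R.
Proof.
move=> T0 h0 d0 e0 ed C0 k0 B0 Nle thetaE.
set u := Num.sqrt h; have u0 : (0 < u)%R by rewrite sqrtr_gt0.
have hE : h = (u ^+ 2)%R by rewrite sqr_sqrtr// ltW.
have un0 : u != 0%R by exact: lt0r_neq0.
set D := (16 / k ^+ 2 * B)%R.
have D0 : (0 <= D)%R by rewrite mulr_ge0// divr_ge0// sqr_ge0.
have -> : (1 + theta * (eps * h) + 16 / (k / h) ^+ 2 * theta ^+ 2 * B = 1 + (eps * u + D * u ^+ 2))%R.
  rewrite thetaE -/u hE /D; field.
  by rewrite un0 lt0r_neq0.
set z := (eps * u + D * u ^+ 2)%R.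
have z0 : (0 <= z)%R.
  by apply: addr_ge0; apply: mulr_ge0; rewrite ?sqr_ge0//; exact: ltW.
have zN : ((1 + z) ^+ N <= expR (dlt / (4 * u)) * expR (T * D))%R.
  apply: (@le_trans _ _ (expR z ^+ N)%R).
    apply: lerXn2r; rewrite ?nnegrE ?expR_ge0//; first exact: addr_ge0.
    exact: expR_ge1Dx.
  rewrite -expRM_natl -expRD ler_expR.
  apply: (@le_trans _ _ (T / h * z)%R); first exact: ler_wpM2r.
  have -> : (T / h * z = T * eps / u + T * D)%R by rewrite /z hE; field.
  rewrite lerD2r ler_pdivrMr// (_ : (dlt / (4 * u) * u = dlt / 4)%R); last by field.
  by move: ed; rewrite ler_pdivlMr ?mulr_gt0//; lra.
have e2 : (expR (- (theta * dlt / 2)) * expR (dlt / (4 * u)) <= (12 / dlt) ^+ 3 * u ^+ 3)%R.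
  rewrite -expRD (_ : (_ + _)%R = (- (dlt / (4 * u)))%R); last first.
    by rewrite thetaE -/u; field.
  apply: le_trans (expRN_le_cube _) _; first by rewrite divr_gt0// mulr_gt0.
  rewrite le_eqVlt; apply/orP; left; apply/eqP; field.
  by rewrite un0 lt0r_neq0.
apply: (@le_trans _ _ (T / h * (C * expR (- (theta * dlt / 2)) *
  (2 * (expR (dlt / (4 * u)) * expR (T * D)))))%R).
  apply: ler_pM => //.
    by rewrite !mulr_ge0 ?expR_ge0// exprn_ge0// addr_ge0.
  by apply: ler_wpM2l; [rewrite mulr_ge0 ?expR_ge0|apply: ler_wpM2l].
have -> : (T / h * (C * expR (- (theta * dlt / 2)) * (2 * (expR (dlt / (4 * u)) * expR (T * D)))) =
  (2 * C * T * expR (T * D)) * (u ^- 2 * (expR (- (theta * dlt / 2)) * expR (dlt / (4 * u)))))%R.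
  rewrite hE; field; exact: un0.
rewrite -[leRHS]mulrA; apply: ler_wpM2l.
  by rewrite !mulr_ge0 ?expR_ge0// ltW.
rewrite mulrC ler_pdivrMr ?exprn_gt0//; apply: le_trans e2 _.
by rewrite le_eqVlt; apply/orP; left; apply/eqP; ring.
Qed.

Theorem corollary5p4 (d : measure_display) (R : realType)
    (Omega : measurableType d) (I : set R) (l r : \bar R)
    (F : R -> set (set Omega)) (P : R -> probability Omega R)
    (Y : R -> Omega -> R) (m : {measure set R -> \bar R})
    (hbar : R) (a : R -> \bar R -> R)
    (HY : general_diffusion I l r F P Y m)
    (Hhbar : (0 < hbar)%R)
    (Ha : scale_factors I l r hbar a)
    (Hsmall : hbar_small l r m hbar a)
    (Herr : is_little_o_id (scale_error l r m a))
    (alpha T y : R) (Halpha : (0 < alpha)%R) (HT : (0 < T)%R)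
    (Hy : interior_of l r y) :
  'N[P y]_(alpha%:E)[max_time_error l r P Y m a T h] @[h --> 0%R^'+] --> 0.
Proof.
have Iy := diffusion_sub_interior HY Hy.
suff key (e : R) : (0 < e)%R -> \forall h \near 0%R^'+,
    'N[P y]_(alpha%:E)[max_time_error l r P Y m a T h] <= e%:E.
  apply/fine_cvgP; split.
    apply: filterS (key 1%R ltr01) => h; rewrite ge0_fin_numE ?Lnorm_ge0// => H.
    by apply: le_lt_trans H _; rewrite ltry.
  apply/cvgrPdist_le => e e0; apply: filterS (key e e0) => h H /=.
  rewrite sub0r normrN ger0_norm ?fine_ge0 ?Lnorm_ge0//.
  rewrite -lee_fin fineK// ge0_fin_numE ?Lnorm_ge0//.
  by apply: le_lt_trans H _; rewrite ltry.
move=> e0.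
(* chosen so that dlt^alpha is half of e^alpha *)
pose dlt : R := ((e `^ alpha / 2) `^ alpha^-1)%R.
have ea : (0 < e `^ alpha / 2)%R by rewrite divr_gt0// powR_gt0.
have d0 : (0 < dlt)%R by rewrite powR_gt0.
have da : (dlt `^ alpha = e `^ alpha / 2)%R.
  by rewrite /dlt -powRrM mulVf ?lt0r_neq0// powRr1// ltW.
(* 1/2 keeps the radii positive; dlt / (4 T) leaves half of the exponent *)
pose eps : R := (Num.min (1 / 2) (dlt / (4 * T)))%R.
have eps0 : (0 < eps)%R by rewrite lt_min !divr_gt0// mulr_gt0.
have eps1 : (eps <= 1 / 2)%R by rewrite ge_min lexx.
have epsd : (eps <= dlt / (4 * T))%R by rewrite ge_min lexx orbT.
pose C : R := expR (alpha * (ln (2 * alpha) - 1))%R.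
pose B : R := (6 * expR (exit_rate R))%R.
have B0 : (0 <= B)%R by rewrite mulr_ge0// expR_ge0.
pose L : R := (2 * C * T * expR (T * (16 / exit_rate R ^+ 2 * B)) * ((12 / dlt) ^+ 3))%R.
have L0 : (0 < L)%R.
  rewrite /L; apply: mulr_gt0; last by rewrite exprn_gt0// divr_gt0.
  apply: mulr_gt0; last exact: expR_gt0.
  by apply: mulr_gt0 => //; apply: mulr_gt0 => //; exact: expR_gt0.
have k0 := exit_rate_gt0 R.
have small (c : R) : (0 < c)%R -> \forall h \near (0 : R)%R^'+, (Num.sqrt h <= c)%R.
  move=> c0; have c20 : (0 < c ^+ 2)%R by rewrite exprn_gt0.
  have := nbhs_right_lt c20; apply: filterS => h hc.
  by rewrite -[leRHS](gtr0_norm c0) -sqrtr_sqr ler_wsqrtr// ltW.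
have hb := nbhs_right_lt Hhbar.
have hp := nbhs_right_gt (0%R : R).
have s1 := small 1%R ltr01.
have sk := small (exit_rate R / 2)%R (divr_gt0 k0 (ltr0Sn _ 1)).
have sL := small (e `^ alpha / 2 / L)%R (divr_gt0 ea L0).
near=> h.
have h0 : (0 < h)%R by near: h.
have hh : (0 < h < hbar)%R by rewrite h0 /=; near: h.
have HE : scale_error l r m a h <= (eps * h)%:E by near: h; exact: Herr.
have u0 : (0 < Num.sqrt h)%R by rewrite sqrtr_gt0.
have th1 : (1 <= (Num.sqrt h)^-1)%R by rewrite invf_ge1//; near: h.
have thk : ((Num.sqrt h)^-1 <= exit_rate R / h / 2)%R.
  have hE : h = (Num.sqrt h ^+ 2)%R by rewrite sqr_sqrtr// ltW.
  have : (Num.sqrt h <= exit_rate R / 2)%R by near: h.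
  rewrite {3}hE; move: (Num.sqrt h) u0 => u u0 uk.
  rewrite (_ : (_ / 2)%R = (exit_rate R / 2 / u * u^-1)%R); last by field; exact: lt0r_neq0.
  rewrite -[leLHS]mul1r; apply: ler_wpM2r; first by rewrite invr_ge0 ltW.
  by rewrite ler_pdivlMr// mul1r.
have NT : ((Num.truncn (T / h))%:R <= T / h)%R by rewrite truncn_le divr_ge0// ltW.
have := max_error_moment_le HY Ha Hsmall hh eps0 eps1 HE Iy Halpha (ltW d0)
  th1 thk (erefl (Num.truncn (T / h))).
have := deviation_bound_small HT h0 d0 (ltW eps0) epsd
  (expR_ge0 (alpha * (ln (2 * alpha) - 1))) k0 B0 NT (erefl _).
rewrite -/C -/L => b1 b2.
have int_le : \int[P y]_w (`|max_time_error l r P Y m a T h w| `^ alpha) <= (e `^ alpha)%:E.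
  apply: (le_trans b2); rewrite lee_fin da.
  have : (L * Num.sqrt h <= e `^ alpha / 2)%R.
    by rewrite mulrC -ler_pdivlMr//; near: h.
  by move=> b3; have := le_trans b1 b3; rewrite /B; lra.
rewrite unlock.
apply: (@le_trans _ _ ((e `^ alpha)%:E `^ alpha^-1)).
  apply: gt0_ler_poweR => //.
  - by rewrite invr_ge0 ltW.
  - by rewrite in_itv /= leey andbT; apply: integral_ge0 => w _; exact: poweR_ge0.
  - by rewrite in_itv /= leey andbT lee_fin powR_ge0.
by rewrite poweR_EFin -powRrM mulfV ?lt0r_neq0// powRr1// ltW.
Unshelve. all: by end_near. Qed.
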